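(* For every $d\ge0$, the inductive dimension of $\mathcal{S}(\mathbf{R}^d)$ equals $d^2$.
   Context: $\mathcal{S}(\mathbf{R}^d)$ is the space of closed subgroups of $\mathbf{R}^d$ with the Chabauty topology. The (small) inductive dimension is defined by $\mathrm{indim}(\emptyset)=-1$ and $\mathrm{indim}(X)\le n$ iff every point has a basis of closed neighbourhoods whose boundaries have inductive dimension $\le n-1$. *)

(* Defs.v *)
From Stdlib Require Import Reals List.
From Stdlib Require Vectors.Fin.
Open Scope R_scope.

Section Topology.
Variable X : Type.
Variable T : (X -> Prop) -> Prop.

Definition generated (B : (X -> Prop) -> Prop) (O : X -> Prop) : Prop :=
  forall x, O x -> exists l : list (X -> Prop),
    Forall B l /\ (forall S, In S l -> S x) /\
    (forall y, (forall S, In S l -> S y) -> O y).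

Definition openIn (A W : X -> Prop) : Prop :=
  exists O, T O /\ forall x, A x -> (W x <-> O x).
Definition closedIn (A V : X -> Prop) : Prop :=
  exists C, T (fun x => ~ C x) /\ forall x, A x -> (V x <-> C x).
Definition interiorIn (A V : X -> Prop) (x : X) : Prop :=
  A x /\ exists W, openIn A W /\ W x /\ forall y, A y -> W y -> V y.
Definition closureIn (A V : X -> Prop) (x : X) : Prop :=
  A x /\ forall W, openIn A W -> W x -> exists y, A y /\ W y /\ V y.
Definition boundaryIn (A V : X -> Prop) (x : X) : Prop :=
  closureIn A V x /\ ~ interiorIn A V x.

(** Small inductive dimension of the subspace A:
    [ind_le n A] means indim(A) <= n - 1 (so [ind_le 0 A] iff A is empty).
    indim(A) <= n iff every point of A has a basis of closed (in A)
    neighbourhoods whose boundaries (in A) have indim <= n-1. *)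
Fixpoint ind_le (n : nat) (A : X -> Prop) : Prop :=
  match n with
  | O => forall x, ~ A x
  | S m => forall x, A x -> forall U, openIn A U -> U x ->
      exists V, closedIn A V /\ (forall y, A y -> V y -> U y) /\
        interiorIn A V x /\ ind_le m (boundaryIn A V)
  end.

Definition indim_eq (A : X -> Prop) (n : nat) : Prop :=
  ind_le (S n) A /\ ~ ind_le n A.
End Topology.

Arguments generated {X} B O.
Arguments ind_le {X} T n A.
Arguments indim_eq {X} T A n.

Definition Vec (d : nat) : Type := Fin.t d -> R.
Definition vzero {d} : Vec d := fun _ => 0.
Definition vadd {d} (x y : Vec d) : Vec d := fun i => x i + y i.
Definition vopp {d} (x : Vec d) : Vec d := fun i => - x i.

Definition openR {d} (U : Vec d -> Prop) : Prop :=
  forall x, U x -> exists eps, 0 < eps /\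
    forall y, (forall i, Rabs (y i - x i) < eps) -> U y.
Definition closedR {d} (F : Vec d -> Prop) : Prop := openR (fun x => ~ F x).

Definition compactR {d} (K : Vec d -> Prop) : Prop :=
  forall (I : Type) (G : I -> Vec d -> Prop),
    (forall i, openR (G i)) -> (forall x, K x -> exists i, G i x) ->
    exists l : list I, forall x, K x -> exists i, In i l /\ G i x.

Definition closed_subgroup {d} (H : Vec d -> Prop) : Prop :=
  H vzero /\ (forall x y, H x -> H y -> H (vadd x y)) /\
  (forall x, H x -> H (vopp x)) /\ closedR H.

(** Chabauty topology: generated by {F | F ∩ K = ∅} (K compact) and
    {F | F ∩ U ≠ ∅} (U open).  We put it on all subsets of R^d; its
    restriction to closed sets is the Chabauty topology, and the
    subspace S(R^d) gets the induced topology. *)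
Definition chabauty_subbasis {d} (O : (Vec d -> Prop) -> Prop) : Prop :=
  (exists K, compactR K /\ forall F, O F <-> (forall x, ~ (F x /\ K x))) \/
  (exists U, openR U /\ forall F, O F <-> (exists x, F x /\ U x)).

Definition chabauty_open {d} : ((Vec d -> Prop) -> Prop) -> Prop :=
  generated (@chabauty_subbasis d).

(* Main.v *)
(** Every closed subgroup H of R^d is A(Y) for a d x d matrix A, where Y is the group of
    vectors whose coordinates range over R, Z or {0} according to a type tau of the columns;
    A can be normalised so that the rows indexed by the R-columns are unit vectors.  On small
    closed sets of normalised matrices A |-> A(Y) is injective and continuous, so the space of
    closed subgroups is a countable union of compact sets parametrised by matrices.  The
    matrices with exactly i irrational entries form a zero-dimensional set; by the countable
    sum theorem the whole space is a union of d^2 + 1 zero-dimensional sets, hence has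
    inductive dimension at most d^2.

    Conversely, if the dimension were at most d^2 - 1 then the space would be a union of d^2
    zero-dimensional sets.  Parametrise a cube of matrices near the identity by [0,1]^(d^2) and
    map a matrix A to the lattice A(Z^d).  The images of the two opposite faces in the i-th
    direction are separated by a closed set missing the i-th zero-dimensional set, so these
    d^2 partitions have no common point, against the Poincare-Miranda theorem.  The latter is
    proved on a grid by evaluating the mod 2 cup product of the d^2 partitions, which is 1. *)
Require Import Defs.
From HB Require Import structures.
From Stdlib Require Import Reals List Lra Lia ZArith.
From Stdlib Require Import Classical ClassicalEpsilon FunctionalExtensionality PropExtensionality.
From Stdlib Require Vectors.Fin.
From mathcomp Require Import all_boot.
Set Implicit Arguments.
Unset Strict Implicit.
Unset Printing Implicit Defensive.
Local Open Scope R_scope.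

(** * The mod 2 cubical cup product *)

(** The groups of one type do not form a closed set: the lattices generated by 1/n in R converge to
    R, which has another type. A lower bound |y| <= C |A y| on the used coefficients y excludes such
    collapses. With C fixed and the entries bounded, limits of groups are groups of limit matrices,
    and the type, an integral C and a rational centre take countably many values. Two matrices with
    the same group differ by a change of basis; its continuous part is removed by the normalisation,
    and the rest is integral, hence removed by making the charts small compared with 1/C.

    Zero-dimensional pieces are in general not closed, so dimension theory is developed for
    arbitrary subsets of a separable pseudometric space, with relatively clopen sets cut out by
    ambient open or closed sets. The pseudometric lives on all subsets of R^d, where distinct points
    may have distance 0; it is compared with the Chabauty topology on closed subgroups, which
    suffices because dimension is intrinsic to the subspace. *)

Section Update.
Variables (J : eqType) (T : Type).
Implicit Types (x : J -> T) (i j : J) (s t : T).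

Definition upd x j t : J -> T := fun i => if i == j then t else x i.

Lemma upd_same x j t : upd x j t j = t.
Proof. by rewrite /upd eqxx. Qed.

Lemma upd_other x j t i : i != j -> upd x j t i = x i.
Proof. by rewrite /upd => /negbTE->. Qed.

Lemma updC x i j s t : i != j -> upd (upd x i s) j t = upd (upd x j t) i s.
Proof.
move=> ij; apply: functional_extensionality => k; rewrite /upd.
by have [->|//] := eqVneq k j; rewrite eq_sym (negbTE ij).
Qed.

Lemma upd_upd x j s t : upd (upd x j s) j t = upd x j t.
Proof. by apply: functional_extensionality => k; rewrite /upd; case: eqP. Qed.
End Update.

Section CubicalCup.
Local Open Scope nat_scope.
Variable J : finType.
Implicit Types (v w : J -> nat) (S : {set J}) (L : seq J).

Definition shift v j := upd v j (v j).+1.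

Lemma shiftC v i j : shift (shift v i) j = shift (shift v j) i.
Proof.
have [->//|ij] := eqVneq i j.
by rewrite /shift !(upd_other v) // 1?eq_sym // updC.
Qed.

Variable l : J -> (J -> nat) -> bool.

(* The mod 2 cubical cup product of the coboundaries of the [l a], [a] in [L], evaluated on
   the unit cube with lowest vertex [v] and edge directions [S]. *)
Fixpoint omega L v S : bool :=
  if L is a :: L' then
    \big[addb/false]_(j in S) ((l a (shift v j) (+) l a v) && omega L' (shift v j) (S :\ j))
  else true.

(** Each unordered pair of directions is counted twice, which is 0 mod 2; [enum_rank] picks one
    order of each pair. *)
Lemma sum_symmetric S (g : J -> J -> bool) : (forall i j, g i j = g j i) ->
  \big[addb/false]_(i in S) \big[addb/false]_(j in S :\ i) g i j = false.
Proof.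
move=> gC.
pose lt (i j : J) := (enum_rank i < enum_rank j)%N.
have -> : \big[addb/false]_(i in S) \big[addb/false]_(j in S :\ i) g i j =
  \big[addb/false]_(i in S) (\big[addb/false]_(j in S | lt i j) g i j) (+)
  \big[addb/false]_(i in S) (\big[addb/false]_(j in S | lt j i) g i j).
  rewrite -big_split /=; apply: eq_bigr => i _.
  rewrite (bigID (lt i)) /=; congr addb; apply: eq_bigl => j; rewrite !inE /lt.
    by have [->|_] := eqVneq j i; rewrite ?ltnn ?andbF.
  rewrite -leqNgt leq_eqVlt (inj_eq (@ord_inj _)) (inj_eq (@enum_rank_inj J)).
  by have [->|_] := eqVneq j i; rewrite /= ?ltnn ?andbF ?andbT.
have -> : \big[addb/false]_(i in S) (\big[addb/false]_(j in S | lt j i) g i j) =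
          \big[addb/false]_(i in S) (\big[addb/false]_(j in S | lt i j) g i j).
  rewrite (exchange_big_dep (mem S)) /=; last by move=> i j _ /andP[].
  by apply: eq_bigr => i iS; apply: eq_big => [j|j _]; rewrite ?iS.
exact: addbb.
Qed.

Lemma addb_eq (a b : bool) : a (+) b = false -> a = b.
Proof. by case: a; case: b. Qed.

(** The cup product of coboundaries is a cocycle. Expanding gives four double sums. In [A], and in
    [D] once induction has removed the shift from [omega], the two directions enter symmetrically
    and the terms cancel in pairs; induction turns [B] into [C] up to exchanging the directions. *)
Lemma omega_closed L v S :
  \big[addb/false]_(j in S) (omega L (shift v j) (S :\ j) (+) omega L v (S :\ j))
  = false.
Proof.
elim: L v S => [|a L IH] v S /=; first by rewrite big1.
have closed w (T : {set J}) : \big[addb/false]_(j in T) omega L (shift w j) (T :\ j) =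
     \big[addb/false]_(j in T) omega L w (T :\ j).
  by apply: addb_eq; rewrite -big_split.
pose A := \big[addb/false]_(i in S) \big[addb/false]_(j in S :\ i)
   (l a (shift (shift v i) j) && omega L (shift (shift v i) j) (S :\ i :\ j)).
pose B := \big[addb/false]_(i in S) \big[addb/false]_(j in S :\ i)
   (l a (shift v i) && omega L (shift (shift v i) j) (S :\ i :\ j)).
pose C := \big[addb/false]_(i in S) \big[addb/false]_(j in S :\ i)
   (l a (shift v j) && omega L (shift v j) (S :\ i :\ j)).
pose D := \big[addb/false]_(i in S) \big[addb/false]_(j in S :\ i)
   (l a v && omega L (shift v j) (S :\ i :\ j)).
have DC i j : S :\ i :\ j = S :\ j :\ i by apply/setP=> k; rewrite !inE andbCA.
have -> : \big[addb/false]_(j in S)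
   (\big[addb/false]_(j0 in S :\ j)
       ((l a (shift (shift v j) j0) (+) l a (shift v j)) &&
        omega L (shift (shift v j) j0) (S :\ j :\ j0)) (+)
    \big[addb/false]_(j0 in S :\ j)
       ((l a (shift v j0) (+) l a v) && omega L (shift v j0) (S :\ j :\ j0)))
  = (A (+) B) (+) (C (+) D).
  rewrite big_split /=; congr addb; rewrite -big_split /=; apply: eq_bigr => i _;
  by rewrite -big_split /=; apply: eq_bigr => j _; rewrite andb_addl.
have -> : A = false.
  apply: (@sum_symmetric S (fun i j => l a (shift (shift v i) j) &&
    omega L (shift (shift v i) j) (S :\ i :\ j))) => i j.
  by rewrite shiftC DC.
have -> : D = false.
  have -> : D = \big[addb/false]_(i in S) \big[addb/false]_(j in S :\ i)
     (l a v && omega L v (S :\ i :\ j)).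
    by apply: eq_bigr => i _; rewrite -!big_distrr /= closed.
  by apply: sum_symmetric => i j; rewrite DC.
have -> : B = C.
  have -> : B = \big[addb/false]_(i in S) \big[addb/false]_(j in S :\ i)
     (l a (shift v i) && omega L (shift v i) (S :\ i :\ j)).
    by apply: eq_bigr => i _; rewrite -!big_distrr /= closed.
  rewrite /C [RHS](exchange_big_dep (mem S)) /=; last by move=> i j _; rewrite inE => /andP[].
  apply: eq_bigr => j jS; apply: eq_big => [i|i _]; last by rewrite DC.
  by rewrite !inE jS eq_sym andbT andbC.
by rewrite addbF addFb addbb.
Qed.

Variable m : nat.

Definition in_grid v := forall j, (v j <= m)%N.

Lemma in_grid_upd v a t : in_grid v -> (t <= m)%N -> in_grid (upd v a t).
Proof. by move=> gv tm i; rewrite /upd; case: ifP. Qed.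

(** The directions in [L] run over the lowest vertices of unit cubes, hence stop before [m]. The
    other coordinates are read off [v], so a face of the grid is summed by dropping its direction
    from [L] and fixing that coordinate in [v]. *)
Fixpoint gsum L (F : (J -> nat) -> bool) v : bool :=
  if L is a :: L' then \big[addb/false]_(0 <= t < m) gsum L' F (upd v a t) else F v.

Lemma gsum_add L F G v :
  gsum L (fun x => F x (+) G x) v = gsum L F v (+) gsum L G v.
Proof.
elim: L v => //= a L IH v; rewrite -big_split.
by apply: eq_bigr => t _; apply: IH.
Qed.

Lemma gsum_eq L F G v : uniq L -> in_grid v ->
  (forall w, in_grid w -> (forall j, j \in L -> w j < m)%N ->
     (forall j, j \notin L -> w j = v j) -> F w = G w) ->
  gsum L F v = gsum L G v.
Proof.
elim: L v => [|a L IH] v /= uL gv e.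
  by apply: e => // j; rewrite inE.
case/andP: uL => aL uL; apply: eq_big_nat => t /andP[_ tm]; apply: IH => //.
  exact: (in_grid_upd _ gv (ltnW tm)).
move=> w gw wL wv; apply: e => // j; rewrite inE.
  case/orP=> [/eqP->|]; last exact: wL.
  by rewrite (wv _ aL) upd_same.
by rewrite negb_or => /andP[ja jL]; rewrite (wv _ jL) upd_other.
Qed.

Lemma gsum0 L v : gsum L (fun=> false) v = false.
Proof. by elim: L v => //= a L IH v; rewrite big1. Qed.

Lemma gsum_sum (I : Type) (T : seq I) L (G : I -> (J -> nat) -> bool) w :
  gsum L (fun x => \big[addb/false]_(j <- T) G j x) w =
  \big[addb/false]_(j <- T) gsum L (G j) w.
Proof.
elim: T => [|j T IHT].
  rewrite big_nil -[RHS](gsum0 L w); congr (gsum _ _ _).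
  by apply: functional_extensionality => x; rewrite big_nil.
rewrite big_cons -IHT -gsum_add; congr (gsum _ _ _).
by apply: functional_extensionality => x; rewrite big_cons.
Qed.

Lemma gsum_shift L F v a : a \notin L ->
  gsum L (fun x => F (shift x a)) v = gsum L F (shift v a).
Proof.
elim: L v => //= b L IH v; rewrite inE negb_or => /andP[ab aL].
apply: eq_bigr => t _; rewrite IH //.
by rewrite /shift upd_other // updC 1?eq_sym.
Qed.

Lemma gsum_telescope L F v j : uniq L -> j \in L ->
  gsum L (fun x => F (shift x j) (+) F x) v =
  gsum (rem j L) F (upd v j m) (+) gsum (rem j L) F (upd v j 0).
Proof.
elim: L v => //= a L IH v /andP[aL uL]; rewrite inE.
have [->|ja] /= := eqVneq j a.
  move=> _.
  pose g t := gsum L F (upd v a t).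
  rewrite (eq_bigr (fun t => g t.+1 (+) g t)).
    rewrite -[RHS]/(g m (+) g 0%N).
    elim: (m) => [|n IHn]; first by rewrite big_geq // addbb.
    rewrite big_nat_recr //= IHn.
    by case: (g n.+1); case: (g n); case: (g 0%N).
  by move=> t _; rewrite gsum_add gsum_shift // /shift upd_same upd_upd.
move=> jL; rewrite -big_split; apply: eq_bigr => t _ /=.
by rewrite IH // !(updC v _ _ ja).
Qed.

(** Only vertices of the cube spanned by [S] enter [omega L v S]. Where [l a] is constant on them
    its coboundary, a factor of every term, vanishes. *)
Lemma omega_const L v S (b : bool) (a : J) : a \in L ->
  (forall w, (forall i, v i <= w i <= v i + (i \in S))%N -> l a w = b) ->
  omega L v S = false.
Proof.
elim: L v S => //= c L IH v S; rewrite inE => aL lb.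
apply: big1 => j jS.
have sh w : (forall i, shift v j i <= w i <= shift v j i + (i \in S :\ j))%N ->
   (forall i, v i <= w i <= v i + (i \in S))%N.
  move=> H i; move: (H i); rewrite /shift /upd !inE.
  have [->|_] := eqVneq i j; last by [].
  by rewrite jS addn0 addn1 => /andP[/ltnW-> ->].
case/orP: aL => [/eqP ac|aL].
  have -> : l c (shift v j) = b.
    by rewrite -ac; apply: lb => i; apply: sh => k; rewrite leqnn leq_addr.
  have -> : l c v = b by rewrite -ac; apply: lb => i; rewrite leqnn leq_addr.
  by rewrite addbb.
by rewrite (IH (shift v j) _ aL) ?andbF // => w /sh; apply: lb.
Qed.

Hypothesis l_bot : forall j v, in_grid v -> v j = 0%N -> l j v = false.
Hypothesis l_top : forall j v, in_grid v -> v j = m -> l j v = true.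

(* Stokes: [omega (a :: L)] is the coboundary of [l a] times [omega L], and the latter
   vanishes on every face of the grid except the top [a]-face. *)
Lemma omega_total L v : uniq L -> in_grid v ->
  gsum L (fun x => omega L x [set j in L]) v = true.
Proof.
elim: L v => [|a L IH] v // uaL gv.
have /andP[aL uL] := uaL.
pose S := [set j in a :: L].
pose G j x := l a x && omega L x (S :\ j).
transitivity (gsum (a :: L)
   (fun x => \big[addb/false]_(j <- enum S) (G j (shift x j) (+) G j x)) v).
  congr (gsum _ _ _); apply: functional_extensionality => x; rewrite big_enum /=.
  transitivity (\big[addb/false]_(j in S) (G j (shift x j)) (+)
    l a x && \big[addb/false]_(j in S) omega L (shift x j) (S :\ j)).
    rewrite big_distrr -big_split /=.
    by apply: eq_bigr => j _; rewrite andb_addl.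
  rewrite (_ : \big[addb/false]_(j in S) omega L (shift x j) (S :\ j) =
     \big[addb/false]_(j in S) omega L x (S :\ j)).
    by rewrite big_distrr -big_split.
  by apply: addb_eq; rewrite -big_split; apply: omega_closed.
have vanish j (b : bool) : j \in L ->
    gsum (rem j (a :: L)) (G j) (upd v j (if b then m else 0%N)) = false.
  move=> jL; have ja : a != j by apply: contraNneq aL => ->.
  rewrite -[RHS](gsum0 (rem j (a :: L)) (upd v j (if b then m else 0%N))).
  apply: gsum_eq; first exact: rem_uniq.
    by apply: in_grid_upd => //; case: (b).
  move=> w gw wL wv; rewrite /G (@omega_const _ _ _ b j) ?andbF // => u uw.
  have wj : w j = if b then m else 0%N.
    by rewrite wv ?upd_same // mem_rem_uniq // !inE eqxx.
  have uj : u j = w j.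
    by apply/eqP; move: (uw j); rewrite !inE eqxx addn0 -eqn_leq eq_sym.
  have gu : in_grid u.
    move=> i; have /andP[_ ui] := uw i; apply: leq_trans ui _.
    rewrite !inE; have [->|ij] /= := eqVneq i j; first by rewrite addn0.
    case iL: (_ || _); last by rewrite addn0.
    by rewrite addn1; apply: wL; rewrite mem_rem_uniq // !inE ij iL.
  by move: wj; case: (b) => wj; [apply: l_top|apply: l_bot]; rewrite ?uj.
rewrite gsum_sum big_enum (bigD1 a) ?inE ?eqxx //.
rewrite big1 ?Monoid.mulm1 => [|j /andP[jS ja]]; last first.
  have jL : j \in L by move: jS; rewrite !inE (negbTE ja).
  rewrite (gsum_telescope (G j) v uaL) ?inE ?jL ?orbT //.
  by rewrite (vanish j true) // (vanish j false).
rewrite (gsum_telescope (G a) v uaL) ?mem_head //= eqxx.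
have -> : gsum L (G a) (upd v a 0) = false.
  rewrite -[RHS](gsum0 L (upd v a 0)); apply: gsum_eq => //.
    exact: in_grid_upd.
  by move=> w gw _ wv; rewrite /G l_bot // (wv _ aL) upd_same.
have Sa : S :\ a = [set j in L].
  apply/setP=> j; rewrite !inE; have [->|] := eqVneq j a; rewrite //=.
  by rewrite (negbTE aL).
rewrite addbF -(IH (upd v a m)) //; last exact: in_grid_upd.
apply: gsum_eq => //; first exact: in_grid_upd.
by move=> w gw _ wv; rewrite /G Sa l_top // (wv _ aL) upd_same.
Qed.

(** The total is 1, so [omega] is nonzero on some unit cube; by [omega_const] no label is constant
    there. *)
Lemma cubical_sperner : exists v, (forall j, v j < m)%N /\
  forall j, exists w w', [/\ forall i, (v i <= w i <= (v i).+1)%N,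
     forall i, (v i <= w' i <= (v i).+1)%N, l j w = false & l j w' = true].
Proof.
have g0 : in_grid (fun=> 0%N) by move=> j.
have tot := omega_total (enum_uniq J) g0.
have [v [vm ov]] : exists v, (forall j, v j < m)%N /\ omega (enum J) v [set j in enum J].
  apply: NNPP => H; move: tot; rewrite (_ : gsum _ _ _ = gsum (enum J) (fun=> false) (fun=> 0%N)).
    by rewrite gsum0.
  apply: gsum_eq => //; first exact: enum_uniq.
  move=> w _ wm _; apply/negP => ow; apply: H; exists w; split=> // j.
  by apply: wm; rewrite mem_enum.
exists v; split=> // j.
apply: NNPP => H.
have box w : (forall i, v i <= w i <= v i + (i \in [set j in enum J]))%N ->
   forall i, (v i <= w i <= (v i).+1)%N.
  by move=> wb i; move: (wb i); rewrite inE mem_enum addn1.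
move: ov; rewrite (@omega_const _ _ _ (l j v) j) ?mem_enum // => w /box wb.
case e : (l j w); case e' : (l j v) => //; case: H.
  by exists v, w; split=> // i; rewrite leqnn leqnSn.
by exists w, v; split=> // i; rewrite leqnn leqnSn.
Qed.
End CubicalCup.

(** * Cluster points and the Poincare-Miranda theorem *)

Section Norm.
Variable J : finType.
Implicit Types (x y : J -> R) (j : J) (c t : R).

Definition vplus x y : J -> R := fun j => x j + y j.
Definition vminus x y : J -> R := fun j => x j - y j.
Definition vscale t x : J -> R := fun j => t * x j.

Definition nrm x : R := foldr (fun j => Rmax (Rabs (x j))) 0 (enum J).

Lemma nrm_ge0 x : 0 <= nrm x.
Proof.
rewrite /nrm; elim: (enum J) => [|j L IH] /=; first lra.
exact: Rle_trans IH (Rmax_r _ _).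
Qed.

Lemma nrm_coord x j : Rabs (x j) <= nrm x.
Proof.
rewrite /nrm; have : j \in enum J by rewrite mem_enum.
elim: (enum J) => //= i L IH; rewrite inE => /orP[/eqP->|/IH H]; first exact: Rmax_l.
exact: Rle_trans H (Rmax_r _ _).
Qed.

Lemma nrm_le x c : 0 <= c -> (forall j, Rabs (x j) <= c) -> nrm x <= c.
Proof.
move=> c0 H; rewrite /nrm; elim: (enum J) => //= j L IH; exact: Rmax_lub.
Qed.

Lemma nrm_lt x c : 0 < c -> (forall j, Rabs (x j) < c) -> nrm x < c.
Proof.
move=> c0 H; rewrite /nrm; elim: (enum J) => //= j L IH; exact: Rmax_lub_lt.
Qed.

Lemma nrm_add x y : nrm (vplus x y) <= nrm x + nrm y.
Proof.
apply: nrm_le => [|j]; first by have := nrm_ge0 x; have := nrm_ge0 y; lra.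
have := Rabs_triang (x j) (y j); have := nrm_coord x j; have := nrm_coord y j.
by rewrite /vplus; lra.
Qed.

Lemma nrm_scale_le t x : nrm (vscale t x) <= Rabs t * nrm x.
Proof.
apply: nrm_le => [|j].
  by apply: Rmult_le_pos; [exact: Rabs_pos|exact: nrm_ge0].
rewrite /vscale Rabs_mult; apply: Rmult_le_compat_l; first exact: Rabs_pos.
exact: nrm_coord.
Qed.

Lemma nrm_opp x : nrm (fun j => - x j) = nrm x.
Proof.
by rewrite /nrm; elim: (enum J) => //= j L ->; rewrite Rabs_Ropp.
Qed.

Lemma nrm_minusC x y : nrm (vminus x y) = nrm (vminus y x).
Proof.
rewrite -nrm_opp; congr nrm; apply: functional_extensionality => j.
by rewrite /vminus; lra.
Qed.

Lemma nrm_minus_trans x y z : nrm (vminus x z) <= nrm (vminus x y) + nrm (vminus y z).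
Proof.
apply: Rle_trans (nrm_add _ _); apply: Req_le; congr nrm.
by apply: functional_extensionality => j; rewrite /vminus /vplus; lra.
Qed.

Lemma nrm_minus_lt x y z a b c :
  nrm (vminus x y) < a -> nrm (vminus y z) < b -> a + b <= c -> nrm (vminus x z) < c.
Proof. by have := nrm_minus_trans x y z; lra. Qed.

Lemma nrm_zero_eq x : nrm x <= 0 -> x = fun=> 0.
Proof.
move=> H; apply: functional_extensionality => j.
have := nrm_coord x j; have := Rabs_pos (x j); move=> a b.
by apply: NNPP => /Rabs_pos_lt; lra.
Qed.

Lemma nrm0 : nrm (fun=> 0) = 0.
Proof.
apply: Rle_antisym; last exact: nrm_ge0.
by apply: nrm_le => [|j]; rewrite ?Rabs_R0; lra.
Qed.
End Norm.

(* A predicate [big] such as "nonempty" or "not finitely coverable": every decreasing family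
   of big sets has a cluster value for each bounded real function. *)
Section Grill.
Variables (Y : Type) (big : (Y -> Prop) -> Prop).
Hypothesis big_sub : forall A B : Y -> Prop, (forall y, A y -> B y) -> big A -> big B.
Hypothesis big_union : forall A B : Y -> Prop,
  big (fun y => A y \/ B y) -> big A \/ big B.
Hypothesis big_empty : ~ big (fun=> False).
Variable r : R.

(** The cluster value is the supremum of the cuts below which the values of [g] are negligible on
    some [B e]. Slightly above it they are not, slightly below they are, so the part in between is
    big. *)
Lemma grill_cluster (B : R -> Y -> Prop) (g : Y -> R) :
  (forall e e' y, e <= e' -> B e y -> B e' y) ->
  (forall e, 0 < e -> big (B e)) -> (forall e y, B e y -> Rabs (g y) <= r) ->
  exists t, forall e, 0 < e -> big (fun y => B e y /\ Rabs (g y - t) < e).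
Proof.
move=> mono bB bd.
pose S s := exists e, 0 < e /\ ~ big (fun y => B e y /\ g y < s).
have S_bd : bound S.
  exists (r + 1) => s [e [e0 ns]]; apply: Rnot_lt_le => rs; apply: ns.
  apply: big_sub (bB e e0) => y By; split=> //.
  by have := bd _ _ By; move: (Rle_abs (g y)); lra.
have S_ne : exists s, S s.
  exists (- r - 1), 1; split; first lra.
  move=> bg; apply: big_empty; apply: big_sub bg => y [By gy].
  by have := bd _ _ By; move: (Rle_abs (- g y)); rewrite Rabs_Ropp; lra.
have [t [ub lub]] := completeness S S_bd S_ne.
exists t => e e0.
have [s [[es [es0 ns]] st]] : exists s, S s /\ t - e < s.
  apply: NNPP => H; have := lub (t - e); suff: is_upper_bound S (t - e) by move=> h /(_ h); lra.
  by move=> s Ss; apply: Rnot_lt_le => lt; apply: H; exists s.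
have nS : ~ S (t + e / 2) by move/ub; lra.
set e' := Rmin e es.
have e'0 : 0 < e' by exact: Rmin_glb_lt.
have bg : big (fun y => B e' y /\ g y < t + e / 2).
  by apply: NNPP => H; apply: nS; exists e'.
have : big (fun y => B es y /\ g y < s) \/ big (fun y => B e y /\ Rabs (g y - t) < e).
  apply: big_union; apply: big_sub bg => y [By gy].
  have [lt|ge] := Rlt_le_dec (g y) s; [left|right]; split=> //.
  - exact: mono (Rmin_r _ _) By.
  - exact: mono (Rmin_l _ _) By.
  - by apply: Rabs_def1; lra.
by case=> // /ns.
Qed.

(** One coordinate at a time: the family is shrunk to the points whose earlier coordinates are
    already close. *)
Lemma grill_cluster_vec (J : finType) (B : R -> Y -> Prop) (g : Y -> J -> R) :
  (forall e e' y, e <= e' -> B e y -> B e' y) ->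
  (forall e, 0 < e -> big (B e)) -> (forall e y j, B e y -> Rabs (g y j) <= r) ->
  exists x : J -> R, forall e, 0 < e -> big (fun y => B e y /\ forall j, Rabs (g y j - x j) < e).
Proof.
move=> mono bB bd.
suff [x Hx] : exists x : J -> R, forall e, 0 < e ->
    big (fun y => B e y /\ forall j, j \in enum J -> Rabs (g y j - x j) < e).
  exists x => e /Hx; apply: big_sub => y [By Hy]; split=> // j; apply: Hy.
  by rewrite mem_enum.
elim: (enum J) => [|i L [x Hx]].
  by exists (fun=> 0) => e /bB; apply: big_sub => y By; split.
have [||t Ht] := grill_cluster (g := fun y => g y i) _ Hx.
- move=> e e' y le [By Hy]; split; first exact: mono By.
  by move=> j /Hy; lra.
- by move=> e y [/bd].
exists (upd x i t) => e /Ht; apply: big_sub => y [[By Hy] Hi]; split=> // j.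
rewrite inE /upd; case: eqP => [->//|_] /=; exact: Hy.
Qed.
End Grill.

Lemma cluster_point (Y : Type) (J : finType) (r : R) (P : R -> Y -> Prop) (g : Y -> J -> R) :
  (forall e e' y, e <= e' -> P e y -> P e' y) ->
  (forall e, 0 < e -> exists y, P e y) -> (forall e y j, P e y -> Rabs (g y j) <= r) ->
  exists x, forall e, 0 < e -> exists y, P e y /\ forall j, Rabs (g y j - x j) < e.
Proof.
apply: (@grill_cluster_vec _ (fun A => exists y, A y)).
- by move=> A B AB [y /AB By]; exists y.
- by move=> A B [y [Ay|By]]; [left|right]; exists y.
- by case.
Qed.

Definition vopen (J : finType) (U : (J -> R) -> Prop) :=
  forall x, U x -> exists e, 0 < e /\ forall y, (forall j, Rabs (y j - x j) < e) -> U y.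

(** Heine-Borel. If [K] had no finite subcover, it would have a cluster point near which no finite
    subfamily suffices; the point lies in [K], and one member of the cover contains a neighbourhood
    of it. *)
Lemma bounded_closed_cover (J : finType) (r : R) (K : (J -> R) -> Prop) (I : Type)
    (G : I -> (J -> R) -> Prop) :
  (forall x j, K x -> Rabs (x j) <= r) -> vopen (fun x => ~ K x) ->
  (forall i, vopen (G i)) -> (forall x, K x -> exists i, G i x) ->
  exists l : list I, forall x, K x -> exists i, List.In i l /\ G i x.
Proof.
move=> Kr Kcl Gop Gcov; apply: NNPP => nfc.
pose fc (A : (J -> R) -> Prop) := exists l : list I, forall x, A x -> exists i, List.In i l /\ G i x.
have [||||||x Hx] := @grill_cluster_vec (J -> R) (fun A => ~ fc A) _ _ _ r J (fun=> K) (fun x => x).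
- by move=> A B AB nA [l Hl]; apply: nA; exists l => x /AB /Hl.
- move=> A B nAB; apply: NNPP => /not_or_and[/NNPP[l Hl] /NNPP[l' Hl']].
  apply: nAB; exists (List.app l l') => x [/Hl|/Hl'] [i [il Gi]]; exists i; split=> //.
    by apply: List.in_or_app; left.
  by apply: List.in_or_app; right.
- by case; exists nil.
- by [].
- by [].
- by move=> _ y j; apply: Kr.
have Kx : K x.
  apply: NNPP => /Kcl[e [e0 He]]; apply: (Hx e e0); exists nil => y [Ky /He].
  by case.
have [i Gi] := Gcov _ Kx; have [e [e0 He]] := Gop _ _ Gi.
apply: (Hx e e0); exists (cons i nil) => y [_ /He Gy].
by exists i; split=> //; left.
Qed.

Definition in_cube (J : finType) (x : J -> R) := forall j, 0 <= x j <= 1.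

Definition truth (P : Prop) : bool := if excluded_middle_informative P then true else false.

(** The [l j] are arbitrary sets, each containing one of two opposite faces and missing the other;
    the point found lies on the boundary of all of them at once. *)
Lemma poincare_miranda (J : finType) (l : J -> (J -> R) -> Prop) :
  (forall j x, in_cube x -> x j = 0 -> ~ l j x) ->
  (forall j x, in_cube x -> x j = 1 -> l j x) ->
  exists x, in_cube x /\ forall j e, 0 < e -> exists y z,
    [/\ in_cube y /\ in_cube z, forall i, Rabs (y i - x i) < e,
        forall i, Rabs (z i - x i) < e, ~ l j y & l j z].
Proof.
move=> l0 l1.
pose P e (x : J -> R) := in_cube x /\ forall j, exists y z,
  [/\ in_cube y /\ in_cube z, forall i, Rabs (y i - x i) <= e,
      forall i, Rabs (z i - x i) <= e, ~ l j y & l j z].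
have [|||x Hx] := @cluster_point (J -> R) J 1 P (fun x => x).
- move=> e e' y le [cy Hy]; split=> // j; have [u [v [cuv uy vy lu lv]]] := Hy j.
  by exists u, v; split=> // i; [have := uy i|have := vy i]; lra.
- move=> e e0.
  (* The grid has mesh 1/m below [e], so the vertices of the cube found in it are within [e] of its
     lowest vertex. *)
  have [m [me m0]] := archimed_cor1 e e0.
  have mR : 0 < INR m by exact: lt_0_INR.
  pose pt (v : J -> nat) : J -> R := fun j => INR (v j) / INR m.
  have cube_pt (v : J -> nat) : (forall j, (v j <= m)%N) -> in_cube (pt v).
    move=> vm j; rewrite /pt; split; first exact: Rle_mult_inv_pos (pos_INR _) mR.
    apply: (Rmult_le_reg_r (INR m)) => //; rewrite /Rdiv Rmult_assoc Rinv_l; last lra.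
    by rewrite Rmult_1_r Rmult_1_l; apply: le_INR; apply/leP.
  have [||v [vm Hv]] := @cubical_sperner J (fun j v => truth (l j (pt v))) m.
  + move=> j v gv vj; rewrite /truth; case: excluded_middle_informative => //.
    by move=> lj; case: (l0 j _ (cube_pt _ gv) _ lj); rewrite /pt vj /=; lra.
  + move=> j v gv vj; rewrite /truth; case: excluded_middle_informative => //.
    by case; apply: l1; [exact: cube_pt|rewrite /pt vj; field; lra].
  have near (w : J -> nat) : (forall i, v i <= w i <= (v i).+1)%N ->
      in_cube (pt w) /\ forall i, Rabs (pt w i - pt v i) <= e.
    move=> Hw; split=> [|i].
      by apply: cube_pt => j; have /andP[_ H] := Hw j; apply: leq_trans H (vm j).
    have /andP[/leP/le_INR a /leP/le_INR b] := Hw i; rewrite S_INR in b.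
    have -> : pt w i - pt v i = (INR (w i) - INR (v i)) * / INR m by rewrite /pt; field; lra.
    have im : 0 < / INR m by exact: Rinv_0_lt_compat.
    by apply: Rabs_le; nra.
  exists (pt v); split; first by apply: cube_pt => j; apply: ltnW.
  move=> j; have [w [w' [/near[cw nw] /near[cw' nw']]]] := Hv j.
  rewrite /truth; case: excluded_middle_informative => // nl _.
  by case: excluded_middle_informative => // ll _; exists (pt w), (pt w').
- by move=> e y j [/(_ j) [a b] _]; apply: Rabs_le; lra.
have cx : in_cube x.
  move=> j; split; apply: Rnot_lt_le => lt.
    have [|y [[/(_ j)[a b] _] /(_ j)]] := Hx (- x j); first lra.
    by move/Rabs_def2; lra.
  have [|y [[/(_ j)[a b] _] /(_ j)]] := Hx (x j - 1); first lra.
  by move/Rabs_def2; lra.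
exists x; split=> // j e e0.
have [|y [[cy /(_ j) [u [v [cuv uy vy lu lv]]]] yx]] := Hx (e / 2); first lra.
exists u, v; split=> // i.
  have := Rabs_triang (u i - y i) (y i - x i); have := uy i; have := yx i.
  by replace (u i - y i + (y i - x i)) with (u i - x i); [lra|ring].
have := Rabs_triang (v i - y i) (y i - x i); have := vy i; have := yx i.
by replace (v i - y i + (y i - x i)) with (v i - x i); [lra|ring].
Qed.

(** * Dimension theory of separable pseudometric spaces *)

Lemma choice (T U : Type) (P : T -> U -> Prop) :
  (forall x, exists y, P x y) -> exists g, forall x, P x (g x).
Proof.
move=> H; pose g x := constructive_indefinite_description _ (H x).
by exists (fun x => proj1_sig (g x)) => x; apply: proj2_sig.
Qed.

(** * Suprema and infima of sets of reals *)

Definition sup (S : R -> Prop) : R := epsilon (inhabits 0) (is_lub S).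

Lemma sup_is_lub S : (exists r, S r) -> (exists c, forall r, S r -> r <= c) -> is_lub S (sup S).
Proof.
move=> ne [c bd]; apply: epsilon_spec.
by have [|t Ht] := completeness S _ ne; [exists c|exists t].
Qed.

Definition inf (S : R -> Prop) : R := - sup (fun r => S (- r)).

Section Inf.
Variable S : R -> Prop.
Hypotheses (S_ne : exists r, S r) (S_ge0 : forall r, S r -> 0 <= r).

Let lub : is_lub (fun r => S (- r)) (sup (fun r => S (- r))).
Proof.
apply: sup_is_lub; first by case: S_ne => r Sr; exists (- r); rewrite Ropp_involutive.
by exists 0 => r /S_ge0; lra.
Qed.

Lemma inf_le r : S r -> inf S <= r.
Proof.
case: lub => ub _ Sr; suff: - r <= sup (fun r => S (- r)) by rewrite /inf; lra.
by apply: ub; rewrite Ropp_involutive.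
Qed.

Lemma le_inf c : (forall r, S r -> c <= r) -> c <= inf S.
Proof.
case: lub => _ least H; suff: sup (fun r => S (- r)) <= - c by rewrite /inf; lra.
by apply: least => r /H; lra.
Qed.

Lemma inf_lt c : inf S < c -> exists r, S r /\ r < c.
Proof.
move=> lt; apply: NNPP => H; suff: c <= inf S by lra.
by apply: le_inf => r Sr; apply: Rnot_lt_le => rc; apply: H; exists r.
Qed.
End Inf.

(** Integers are differences of naturals here, so that approximations are indexed by a countable
    type. *)
Lemma real_approx r : exists a b : nat, Rabs (r - (INR a - INR b)) < 1.
Proof.
have [a b] := archimed r.
pose z := (up r - 1)%Z.
exists (Z.to_nat z), (Z.to_nat (- z)).
rewrite !INR_IZR_INZ -minus_IZR.
have -> : (Z.of_nat (Z.to_nat z) - Z.of_nat (Z.to_nat (- z)))%Z = z by lia.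
by rewrite /z minus_IZR; apply: Rabs_def1; lra.
Qed.

(* The pseudometric of the topology generated by countably many real functions. *)
Section Pseudometric.
Variables (K : countType) (X : Type) (f : K -> X -> R).
Implicit Types (x y z : X) (A B C O U V Z : X -> Prop).

Definition weight (k : K) : R := / INR (pickle k).+1.

Lemma weight_gt0 k : 0 < weight k.
Proof. by apply: Rinv_0_lt_compat; apply: lt_0_INR; lia. Qed.

Lemma weight_le1 k : weight k <= 1.
Proof.
rewrite /weight -Rinv_1; apply: Rinv_le_contravar; first lra.
by rewrite S_INR; have := pos_INR (pickle k); lra.
Qed.

(** The truncation weights tend to 0, so a ball constrains finitely many of the functions only. The
    value 0 keeps the set nonempty when [K] is empty. *)
Definition pdist x y : R :=
  sup (fun r => r = 0 \/ exists k, r = Rmin (weight k) (Rabs (f k x - f k y))).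

Lemma pdist_lub x y :
  is_lub (fun r => r = 0 \/ exists k, r = Rmin (weight k) (Rabs (f k x - f k y))) (pdist x y).
Proof.
apply: sup_is_lub; first by exists 0; left.
exists 1 => r [->|[k ->]]; first lra.
exact: Rle_trans (Rmin_l _ _) (weight_le1 k).
Qed.

Lemma pdist_ge0 x y : 0 <= pdist x y.
Proof. by case: (pdist_lub x y) => ub _; apply: ub; left. Qed.

Lemma pdist_ge x y k : Rmin (weight k) (Rabs (f k x - f k y)) <= pdist x y.
Proof. by case: (pdist_lub x y) => ub _; apply: ub; right; exists k. Qed.

Lemma pdist_le x y c : 0 <= c ->
  (forall k, Rmin (weight k) (Rabs (f k x - f k y)) <= c) -> pdist x y <= c.
Proof. by move=> c0 H; case: (pdist_lub x y) => _; apply=> r [->|[k ->]]. Qed.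

Lemma pdistxx x : pdist x x = 0.
Proof.
apply: Rle_antisym; last exact: pdist_ge0.
apply: pdist_le => [|k]; first lra.
by apply: Rle_trans (Rmin_r _ _) _; rewrite Rminus_diag Rabs_R0; lra.
Qed.

Lemma pdistC x y : pdist x y = pdist y x.
Proof.
by apply: Rle_antisym; (apply: pdist_le; first exact: pdist_ge0) => k;
  rewrite Rabs_minus_sym; apply: pdist_ge.
Qed.

Lemma pdist_triangle x y z : pdist x z <= pdist x y + pdist y z.
Proof.
apply: pdist_le => [|k]; first by have := pdist_ge0 x y; have := pdist_ge0 y z; lra.
have := pdist_ge x y k; have := pdist_ge y z k; have := pdist_ge0 x y; have := pdist_ge0 y z.
have := Rabs_triang (f k x - f k y) (f k y - f k z).
replace (f k x - f k y + (f k y - f k z)) with (f k x - f k z) by ring.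
rewrite /Rmin; do 3 case: Rle_dec => ?; lra.
Qed.

Lemma pdist_lt_coord x y k e : pdist x y < e -> e <= weight k -> Rabs (f k x - f k y) < e.
Proof. by have := pdist_ge x y k; rewrite /Rmin; case: Rle_dec => ?; lra. Qed.

Lemma pdist_small e : 0 < e -> exists n : nat, forall x y,
  (forall k, (pickle k < n)%N -> Rabs (f k x - f k y) < e) -> pdist x y <= e.
Proof.
move=> e0; have [n [ne n0]] := archimed_cor1 e e0.
exists n => x y H; apply: pdist_le => [|k]; first lra.
have [lt|ge] := ltnP (pickle k) n.
  by have := H k lt; have := Rmin_r (weight k) (Rabs (f k x - f k y)); lra.
apply: Rle_trans (Rmin_l _ _) _; apply: Rle_trans (Rlt_le _ _ ne).
apply: Rinv_le_contravar; first exact: lt_0_INR.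
by apply: le_INR; apply/leP; apply: leqW.
Qed.

Definition opn O := forall x, O x -> exists e, 0 < e /\ forall y, pdist x y < e -> O y.
Definition cls C := opn (fun x => ~ C x).

Lemma opn_iff O U : (forall x, O x <-> U x) -> opn O -> opn U.
Proof. by move=> H oO x /H/oO[e [e0 He]]; exists e; split=> // y /He/H. Qed.

Lemma opn_and O U : opn O -> opn U -> opn (fun x => O x /\ U x).
Proof.
move=> oO oU x [/oO[e [e0 He]] /oU[e' [e'0 He']]].
exists (Rmin e e'); split; first exact: Rmin_glb_lt.
move=> y lt; split; [apply: He|apply: He'].
  exact: Rlt_le_trans lt (Rmin_l _ _).
exact: Rlt_le_trans lt (Rmin_r _ _).
Qed.

Lemma opn_ex (I : Type) (O : I -> X -> Prop) : (forall i, opn (O i)) -> opn (fun x => exists i, O i x).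
Proof. by move=> oO x [i /oO[e [e0 He]]]; exists e; split=> // y /He; exists i. Qed.

Lemma opn_or O U : opn O -> opn U -> opn (fun x => O x \/ U x).
Proof.
move=> oO oU x [/oO|/oU][e [e0 He]]; exists e; split=> // y /He Oy; [by left|by right].
Qed.

Lemma opn_not_cls O : opn O -> cls (fun x => ~ O x).
Proof. by apply: opn_iff => x; split; [move=> Ox; apply|move/NNPP]. Qed.

Lemma cls_or A B : cls A -> cls B -> cls (fun x => A x \/ B x).
Proof.
by move=> cA cB; apply: opn_iff (opn_and cA cB) => x; split; [case=> nA nB []|move/not_or_and].
Qed.

Lemma cls_and A B : cls A -> cls B -> cls (fun x => A x /\ B x).
Proof.
move=> cA cB; apply: opn_iff (opn_or cA cB) => x; split; first by case=> H [].
exact: not_and_or.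
Qed.

Lemma opn_all_below (I : countType) (O : I -> X -> Prop) n : (forall i, opn (O i)) ->
  opn (fun x => forall i, (pickle i < n)%N -> O i x).
Proof.
move=> oO; elim: n => [|n IH]; first by move=> x _; exists 1; split; first lra.
have on : opn (fun x => forall i, pickle i = n -> O i x).
  have [[i e]|H] := classic (exists i : I, pickle i = n).
    apply: opn_iff (oO i) => x; split; last exact.
    by move=> Ox j; rewrite -e => /(pcan_inj pickleK)->.
  by move=> x _; exists 1; split=> [|y _ i e]; [lra|case: H; exists i].
apply: opn_iff (opn_and IH on) => x; split.
  by case=> lt eq i; rewrite ltnS leq_eqVlt => /orP[/eqP/eq|/lt].
by move=> H; split=> i Hi; apply: H; [apply: ltnW|rewrite Hi].
Qed.

Lemma opn_ball x e : opn (fun y => pdist x y < e).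
Proof.
move=> y xy; exists (e - pdist x y); split; first lra.
by move=> z; have := pdist_triangle x y z; lra.
Qed.

Lemma cls_ball x e : cls (fun y => pdist x y <= e).
Proof.
move=> y /Rnot_le_lt xy; exists (pdist x y - e); split; first lra.
by move=> z; have := pdist_triangle x z y; rewrite (pdistC z y) => ? ? ?; lra.
Qed.

Definition intr A x := exists e, 0 < e /\ forall y, pdist x y < e -> A y.

Lemma opn_intr A : opn (intr A).
Proof.
move=> x [e [e0 He]]; exists (e / 2); split=> [|y xy]; first lra.
exists (e / 2); split=> [|z yz]; first lra.
by apply: He; have := pdist_triangle x y z; lra.
Qed.

Lemma intr_sub A x : intr A x -> A x.
Proof. by case=> e [e0]; apply; rewrite pdistxx. Qed.

Definition basis_index : countType := (nat * seq (nat * nat))%type.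

(** A countable base: [b.1] is both the number of functions constrained and the inverse of the
    tolerance, and [b.2] lists the numerators of the centres. *)
Definition basic (b : basis_index) x := forall k, (pickle k < b.1)%N ->
  Rabs (INR b.1 * f k x - (INR (nth (0, 0)%N b.2 (pickle k)).1 - INR (nth (0, 0)%N b.2 (pickle k)).2)) < 1.

Lemma opn_basic b : opn (basic b).
Proof.
apply: opn_all_below => k x lt.
set c := INR _ - INR _ in lt *.
set n := INR b.1 in lt *; have n0 : 0 <= n by apply: pos_INR.
set d := 1 - Rabs (n * f k x - c); have d0 : 0 < d by rewrite /d; lra.
pose e := Rmin (weight k) (d / (n + 1)).
have dn : 0 < d / (n + 1) by apply: Rdiv_lt_0_compat; lra.
exists e; split; first by apply: Rmin_glb_lt => //; apply: weight_gt0.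
move=> y xy; have H := pdist_lt_coord xy (Rmin_l _ _).
have H' : Rabs (f k x - f k y) < d / (n + 1) by apply: Rlt_le_trans H (Rmin_r _ _).
have := Rabs_triang (n * f k y - n * f k x) (n * f k x - c).
replace (n * f k y - n * f k x + (n * f k x - c)) with (n * f k y - c) by ring.
have -> : n * f k y - n * f k x = n * - (f k x - f k y) by ring.
rewrite Rabs_mult Rabs_Ropp (Rabs_pos_eq n) //.
suff: n * Rabs (f k x - f k y) < d by rewrite /d; lra.
have e1 : d = (n + 1) * (d / (n + 1)) by field; lra.
by have := Rabs_pos (f k x - f k y); nra.
Qed.

Lemma basic_small x e : 0 < e -> exists b, basic b x /\ forall y, basic b y -> pdist x y < e.
Proof.
move=> e0; have [|n Hn] := @pdist_small (e / 2); first lra.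
(* Two points of the same basic set have values at distance below 2/m, and 2/m <= 2/p < e/2. *)
have [p [pe p0]] := archimed_cor1 (e / 4) ltac:(lra).
pose m := maxn n p.
have mp : INR p <= INR m by apply: le_INR; apply/leP; apply: leq_maxr.
have pR : 0 < INR p by apply: lt_0_INR.
have ex (i : nat) : exists ab : nat * nat, forall k, pickle k = i ->
    Rabs (INR m * f k x - (INR ab.1 - INR ab.2)) < 1.
  have [[k e1]|H] := classic (exists k : K, pickle k = i); last first.
    by exists (0, 0)%N => k e1; case: H; exists k.
  have [a [b Hab]] := real_approx (INR m * f k x).
  by exists (a, b) => k'; rewrite -e1 => /(pcan_inj pickleK)->.
have [g Hg] := choice ex.
exists (m, mkseq g m); split=> [k km|y Hy] /=.
  by rewrite nth_mkseq //; apply: Hg.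
apply: Rle_lt_trans (_ : e / 2 < e); last lra.
apply: Hn => k kn; have km : (pickle k < m)%N by apply: leq_trans kn (leq_maxl _ _).
have := Hy k km; rewrite /= nth_mkseq //; have := Hg _ k erefl.
set c := INR _ - INR _ => H1 H2.
have : Rabs (INR m * (f k x - f k y)) < 2.
  replace (INR m * (f k x - f k y)) with ((INR m * f k x - c) + - (INR m * f k y - c)) by ring.
  by apply: Rle_lt_trans (Rabs_triang _ _) _; rewrite Rabs_Ropp; lra.
rewrite Rabs_mult (Rabs_pos_eq (INR m)); last exact: pos_INR.
have : 1 < e / 4 * INR p.
  by have := Rmult_lt_compat_r _ _ _ pR pe; rewrite Rinv_l; lra.
by have := Rabs_pos (f k x - f k y); nra.
Qed.

(** The cap 1 gives the infimum a meaning when [A] is empty. *)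
Definition dset x A : R := inf (fun r => r = 1 \/ exists a, A a /\ r = pdist x a).

Let dset_ne x A : exists r, r = 1 \/ exists a, A a /\ r = pdist x a.
Proof. by exists 1; left. Qed.

Let dset_S_ge0 x A r : (r = 1 \/ exists a, A a /\ r = pdist x a) -> 0 <= r.
Proof. by case=> [->|[a [_ ->]]]; [lra|apply: pdist_ge0]. Qed.

Lemma dset_ge0 x A : 0 <= dset x A.
Proof. exact: (le_inf (dset_ne x A) (@dset_S_ge0 x A) (@dset_S_ge0 x A)). Qed.

Lemma dset_in x A : A x -> dset x A = 0.
Proof.
move=> Ax; apply: Rle_antisym; last exact: dset_ge0.
apply: (inf_le (dset_ne x A) (@dset_S_ge0 x A)).
by right; exists x; rewrite pdistxx.
Qed.

Lemma dset_out x A e : 0 < e -> (forall y, pdist x y < e -> ~ A y) -> 0 < dset x A.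
Proof.
move=> e0 H; apply: Rlt_le_trans (_ : Rmin 1 e <= _); first by apply: Rmin_glb_lt; lra.
apply: (le_inf (dset_ne x A) (@dset_S_ge0 x A)) => r [->|[a [Aa ->]]]; first exact: Rmin_l.
apply: Rle_trans (Rmin_r _ _) _; apply: Rnot_lt_le => /H; exact.
Qed.

Lemma dset_lip x y A : dset x A <= dset y A + pdist x y.
Proof.
suff: dset x A - pdist x y <= dset y A by lra.
apply: (le_inf (dset_ne y A) (@dset_S_ge0 y A)) => r [->|[a [Aa ->]]].
  have := inf_le (dset_ne x A) (@dset_S_ge0 x A) (or_introl erefl).
  by rewrite -/(dset x A); have := pdist_ge0 x y; lra.
have := inf_le (dset_ne x A) (@dset_S_ge0 x A) (or_intror (ex_intro _ a (conj Aa erefl))).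
by rewrite -/(dset x A); have := pdist_triangle x y a; lra.
Qed.

Lemma opn_dset_lt p q A B : 0 <= p -> 0 <= q -> opn (fun x => p * dset x A < q * dset x B).
Proof.
move=> p0 q0 x lt; set d := q * dset x B - p * dset x A.
have e0 : 0 < d / (p + q + 1) by apply: Rdiv_lt_0_compat; rewrite /d; lra.
exists (d / (p + q + 1)); split=> // y xy.
have h1 := dset_lip y x A; have h2 := dset_lip x y B; rewrite (pdistC y x) in h1.
have e1 : d = (p + q + 1) * (d / (p + q + 1)) by field; lra.
have := pdist_ge0 x y; rewrite /d in e0 e1 xy *; nra.
Qed.

Lemma cls_dset_le p q A B : 0 <= p -> 0 <= q -> cls (fun x => p * dset x A <= q * dset x B).
Proof.
move=> p0 q0; apply: opn_iff (opn_dset_lt q0 p0 (A := B) (B := A)) => x; lra.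
Qed.

(* Pointwise and large zero-dimensionality of [Z]; clopen subsets of [Z] are given by pairs of
   closed, resp. open, subsets of [X] which need only be complementary on [Z]. *)
Definition zd Z := forall x e, Z x -> 0 < e -> exists V W,
  [/\ cls V, cls W, forall y, Z y -> V y \/ W y, forall y, Z y -> V y -> ~ W y &
      V x /\ forall y, Z y -> V y -> pdist x y < e].

Definition zd_large Z := forall A B, cls A -> cls B -> (forall x, Z x -> A x -> ~ B x) ->
  exists U V, [/\ opn U, opn V, forall x, Z x -> U x \/ V x, forall x, Z x -> U x -> ~ V x &
    (forall x, Z x -> A x -> U x) /\ (forall x, Z x -> B x -> V x)].

Lemma zd_sub Z Z' : (forall x, Z' x -> Z x) -> zd Z -> zd Z'.
Proof.
move=> sub zZ x e /sub Zx e0; have [V [W [cV cW cov dis [Vx Ve]]]] := zZ x e Zx e0.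
exists V, W; split=> // [y /sub/cov//|y /sub/dis//|].
by split=> // y /sub; apply: Ve.
Qed.

Lemma zd_of_large Z : zd_large Z -> zd Z.
Proof.
move=> zZ x e Zx e0.
have [|||U [V [oU oV cov dis [AU BV]]]] := zZ (fun y => pdist x y <= e / 2) (fun y => ~ pdist x y < e).
- exact: cls_ball.
- exact: (@opn_not_cls _ (@opn_ball x e)).
- by move=> y _ ? ?; lra.
exists (fun y => ~ V y), (fun y => ~ U y); split.
- exact: opn_not_cls.
- exact: opn_not_cls.
- move=> y /[dup] /cov + /dis; case; tauto.
- by move=> y /cov; tauto.
split=> [|y Zy nV]; last by apply: NNPP => /(BV y Zy).
by apply: dis => //; apply: AU => //; rewrite pdistxx; lra.
Qed.

(** A Lindelof argument: countably many clopen subsets of [Z], each missing [A] or missing [B],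
    cover [Z]. Subtracting the earlier ones makes them disjoint, and they are then sorted by which
    of the two sets they miss. *)
Lemma zd_to_large Z : zd Z -> zd_large Z.
Proof.
move=> zZ A B cA cB dAB.
pose fine (VW : (X -> Prop) * (X -> Prop)) :=
  [/\ cls VW.1, cls VW.2, forall y, Z y -> VW.1 y \/ VW.2 y, forall y, Z y -> VW.1 y -> ~ VW.2 y &
   (forall y, Z y -> VW.1 y -> ~ A y) \/ (forall y, Z y -> VW.1 y -> ~ B y)].
(* One clopen set is chosen for each basic set that fits inside some; the others receive the empty
   set. *)
have [sel Hsel] : exists sel : basis_index -> (X -> Prop) * (X -> Prop), forall b, fine (sel b) /\
    ((exists VW, fine VW /\ forall y, Z y -> basic b y -> VW.1 y) ->
     forall y, Z y -> basic b y -> (sel b).1 y).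
  apply: (choice (P := fun b s => fine s /\ ((exists VW, fine VW /\
    forall y, Z y -> basic b y -> VW.1 y) -> forall y, Z y -> basic b y -> s.1 y))) => b.
  have [[VW [fVW bVW]]|H] := classic (exists VW, fine VW /\ forall y, Z y -> basic b y -> VW.1 y).
    by exists VW.
  exists (fun=> False, fun=> True); split=> //; split=> //=; try by left.
  - by move=> x _; exists 1; split; [lra|move=> y _ []].
  - by move=> y _; right.
have selP b : fine (sel b) by case: (Hsel b).
(* On [Z] this is the [b]-th clopen set minus the earlier ones, written so as to be open in the
   whole space. *)
pose W b x := ~ (sel b).2 x /\ forall c, (pickle c < pickle b)%N -> ~ (sel c).1 x.
have oW b : opn (W b).
  apply: opn_and; first by case: (selP b).
  by apply: opn_all_below => c; case: (selP c).
have cov x : Z x -> exists b, (sel b).1 x.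
  move=> Zx.
  have [e [e0 He]] : exists e, 0 < e /\
      ((forall y, pdist x y < e -> ~ A y) \/ (forall y, pdist x y < e -> ~ B y)).
    have [Ax|/cA[e [e0 He]]] := classic (A x); last by exists e; split=> //; left.
    by have [e [e0 He]] := cB x (dAB x Zx Ax); exists e; split=> //; right.
  have [V [V' [cV cV' cov dis [Vx Ve]]]] := zZ x e Zx e0.
  have [d [d0 Hd]] := cV' x (dis x Zx Vx).
  have [b [bx Hb]] := basic_small x d0.
  exists b; apply: (proj2 (Hsel b)) => //; exists (V, V'); split=> /=.
    by split=> //; case: He => He; [left|right] => y Zy Vy; apply: He; apply: Ve.
  by move=> y Zy /Hb/Hd nV'; case: (cov y Zy).
have Wcov x : Z x -> exists b, W b x.
  move=> Zx; have ex : exists n, truth (exists b, pickle b = n /\ (sel b).1 x).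
    have [b Hb] := cov x Zx; exists (pickle b).
    by rewrite /truth; case: excluded_middle_informative => // -[]; exists b.
  case: (ex_minnP ex) => n; rewrite {1}/truth; case: excluded_middle_informative => // -[b [bn Hb]] _ minn.
  exists b; split; first by case: (selP b) => _ _ _ H _; apply: H.
  move=> c; rewrite bn => cb Hc; have := minn (pickle c); rewrite /truth.
  by case: excluded_middle_informative => [_ /(_ isT)|[]]; [rewrite leqNgt cb|exists c].
have Wdis x b c : Z x -> W b x -> W c x -> b = c.
  move=> Zx [nb Hb] [nc Hc].
  have sb : (sel b).1 x by case: (selP b) => _ _ /(_ x Zx)[].
  have sc : (sel c).1 x by case: (selP c) => _ _ /(_ x Zx)[].
  have [lt|gt|/(pcan_inj pickleK)//] := ltngtP (pickle b) (pickle c).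
    by case: (Hc b lt).
  by case: (Hb c gt).
pose side b := forall y, Z y -> (sel b).1 y -> ~ A y.
exists (fun x => exists b, ~ side b /\ W b x), (fun x => exists b, side b /\ W b x); split.
- by apply: opn_ex => b; apply: opn_and => // x nb; exists 1; split; first lra.
- by apply: opn_ex => b; apply: opn_and => // x nb; exists 1; split; first lra.
- move=> x /Wcov[b Wb]; have [sb|nsb] := classic (side b); first by right; exists b.
  by left; exists b.
- by move=> x Zx [b [nb Wb]] [c [sc Wc]]; apply: nb; rewrite (Wdis x b c).
split=> x Zx Hx; have [b Wb] := Wcov x Zx; exists b; split=> //; have [nb _] := Wb;
  have sb : (sel b).1 x by case: (selP b) => _ _ /(_ x Zx)[].
  by move=> /(_ x Zx sb).
case: (selP b) => _ _ _ _ [//|H].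
by case: (H x Zx sb).
Qed.

(** [A'] is given by 2 d(x,A) <= d(x,B), and [B'] symmetrically. A common point has both distances
    0, hence lies in [A] and in [B]; the factor 2 makes the inequality strict on each set off the
    other, hence stable nearby. *)
Lemma expand_disjoint Z A B : cls A -> cls B -> (forall x, Z x -> A x -> ~ B x) ->
  exists A' B', [/\ cls A', cls B', forall x, Z x -> A' x -> ~ B' x,
    forall x, Z x -> A x -> intr A' x & forall x, Z x -> B x -> intr B' x].
Proof.
move=> cA cB dis.
have far C x : cls C -> ~ C x -> 0 < dset x C.
  by move=> cC /cC[e [e0 He]]; apply: dset_out e0 He.
pose lt A B x := 2 * dset x A < 1 * dset x B.
pose le A B x := 2 * dset x A <= 1 * dset x B.
have olt A1 B1 : opn (lt A1 B1) by apply: opn_dset_lt; lra.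
have cle A1 B1 : cls (le A1 B1) by apply: cls_dset_le; lra.
have lt_intr A1 B1 x : lt A1 B1 x -> intr (le A1 B1) x.
  by move=> /olt[e [e0 He]]; exists e; split=> // y /He; rewrite /lt /le; lra.
exists (le A B), (le B A); split=> //.
- move=> x Zx; rewrite /le => h1 h2.
  have := dset_ge0 x A; have := dset_ge0 x B => b0 a0.
  have nA : ~ ~ A x by move/(far A x cA); lra.
  have nB : ~ ~ B x by move/(far B x cB); lra.
  exact: (dis x Zx (NNPP _ nA) (NNPP _ nB)).
- move=> x Zx Ax; apply: lt_intr; rewrite /lt dset_in //.
  by have := far B x cB (dis x Zx Ax); lra.
- move=> x Zx Bx; apply: lt_intr; rewrite /lt [dset x B]dset_in //.
  by have := far A x cA (fun Ax => dis x Zx Ax Bx); lra.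
Qed.

(** The countable sum theorem. Closed pairs, disjoint on [Z], are enlarged so that each lies on [Z]
    in the interior of the next and the step of index [i] absorbs [Z] within [C i]. The unions of
    the interiors are open and split [Z]. *)
Lemma zd_sum (I : countType) (C : I -> X -> Prop) Z : (forall i, cls (C i)) ->
  (forall x, Z x -> exists i, C i x) -> (forall i, zd (fun x => Z x /\ C i x)) -> zd Z.
Proof.
move=> cC cov zC; apply: zd_of_large => A B cA cB dAB.
pose state := ((X -> Prop) * (X -> Prop))%type.
pose inv (s : state) := [/\ cls s.1, cls s.2 & forall x, Z x -> s.1 x -> ~ s.2 x].
pose step (n : nat) (s t : state) := [/\ forall x, Z x -> s.1 x -> intr t.1 x,
  forall x, Z x -> s.2 x -> intr t.2 x &
  forall i x, pickle i = n -> Z x -> C i x -> intr t.1 x \/ intr t.2 x].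
have next n (s : state) : exists t, inv s -> inv t /\ step n s t.
  have [isn|ninv] := classic (inv s); last by exists s => /ninv.
  case: s isn => P Q [/= cP cQ dPQ].
  have [P' [Q' [cP' cQ' dPQ' [PP' QQ'] covn]]] : exists P' Q',
      [/\ cls P', cls Q', forall x, Z x -> P' x -> ~ Q' x,
          (forall x, P x -> P' x) /\ (forall x, Q x -> Q' x) &
          forall i x, pickle i = n -> Z x -> C i x -> P' x \/ Q' x].
    have [[i ein]|H] := classic (exists i : I, pickle i = n); last first.
      by exists P, Q; split=> // i x e; case: H; exists i.
    (* [Z] within [C i] is split along the current pair. The halves are added as [C i] minus an open
       set, which is closed in the whole space. *)
    have [||x [Zx _]|U [V [oU oV cUV dUV [PU QV]]]] := zd_to_large (zC i) (A := P) (B := Q) => //.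
      exact: dPQ.
    exists (fun x => P x \/ C i x /\ ~ V x), (fun x => Q x \/ C i x /\ ~ U x); split.
    - by apply: cls_or => //; apply: cls_and => //; apply: opn_not_cls.
    - by apply: cls_or => //; apply: cls_and => //; apply: opn_not_cls.
    - move=> x Zx [Px|[Cx nV]] [Qx|[Cx' nU]].
      + exact: dPQ Qx.
      + by apply: nU; apply: PU.
      + by apply: nV; apply: QV.
      + by case: (cUV x (conj Zx Cx)).
    - by split=> x; left.
    - move=> j x; rewrite -ein => /(pcan_inj pickleK)-> Zx Cx.
      have [Ux|Vx] := cUV x (conj Zx Cx); [left|right]; right; split=> //.
        exact: dUV Ux.
      by move=> Ux; apply: dUV Vx.
  have [P2 [Q2 [cP2 cQ2 d2 iP iQ]]] := expand_disjoint cP' cQ' dPQ'.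
  exists (P2, Q2) => _; split; split=> //=.
  - by move=> x Zx /PP'; apply: iP.
  - by move=> x Zx /QQ'; apply: iQ.
  - by move=> i x e Zx Cx; case: (covn i x e Zx Cx) => H; [left; apply: iP|right; apply: iQ].
have [nxt Hnxt] := choice (P := fun ns t => inv ns.2 -> inv t /\ step ns.1 ns.2 t) (fun ns => next ns.1 ns.2).
pose s := fix s n : state := if n is p.+1 then nxt (p, s p) else (A, B).
have inv_s n : inv (s n).
  by elim: n => [|n IH]; [split|case: (Hnxt (n, s n) IH)].
have step_s n : step n (s n) (s n.+1) by case: (Hnxt (n, s n) (inv_s n)).
have mono n p x : Z x -> (n <= p)%N -> ((s n).1 x -> (s p).1 x) /\ ((s n).2 x -> (s p).2 x).
  move=> Zx /subnK <-; elim: (p - n)%N => //= q [IH1 IH2].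
  have [h1 h2 _] := step_s (q + n)%N; rewrite -/s.
  by split=> [/IH1/(h1 x Zx)|/IH2/(h2 x Zx)] /intr_sub.
exists (fun x => exists n, intr (s n).1 x), (fun x => exists n, intr (s n).2 x); split.
- by apply: opn_ex => n; apply: opn_intr.
- by apply: opn_ex => n; apply: opn_intr.
- move=> x Zx; have [i Cx] := cov x Zx; have [_ _ H] := step_s (pickle i).
  by case: (H i x erefl Zx Cx) => Hx; [left|right]; exists (pickle i).+1.
- move=> x Zx [n /intr_sub xn] [p /intr_sub xp].
  have [_ _ dis] := inv_s (maxn n p); apply: (dis x Zx).
    by apply: (proj1 (mono n _ x Zx _) xn); apply: leq_maxl.
  by apply: (proj2 (mono p _ x Zx _) xp); apply: leq_maxr.
have [h1 h2 _] := step_s 0%N.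
by split=> x Zx Hx; exists 1%N; [apply: h1|apply: h2].
Qed.

(** After enlarging [A] and [B], a clopen splitting of [Z] adds its halves to [A] and [B] without
    either resulting set [S], [T] meeting the closure of the other. The points nearer to [S] and
    those nearer to [T] are then disjoint open sets covering [Z]. *)
Lemma separate_off_zd A B Z : cls A -> cls B -> (forall x, A x -> ~ B x) -> zd Z ->
  exists U V, [/\ opn U, opn V, forall x, U x -> ~ V x, forall x, Z x -> U x \/ V x &
    (forall x, A x -> U x) /\ (forall x, B x -> V x)].
Proof.
move=> cA cB dAB zZ.
have [A' [B' [cA' cB' dAB' iA iB]]] :=
  expand_disjoint (Z := fun=> True) cA cB (fun x _ => dAB x).
have [|U [V [oU oV cov dis [AU BV]]]] := zd_to_large zZ cA' cB'.
  by move=> x _; apply: dAB'.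
pose S x := A x \/ Z x /\ U x; pose T x := B x \/ Z x /\ V x.
have far_gt0 P x : intr (fun y => ~ P y) x -> 0 < dset x P.
  by case=> e [e0 He]; apply: dset_out e0 He.
have AT x : A x -> intr (fun y => ~ T y) x.
  move=> Ax; have [e [e0 He]] := opn_and (@opn_intr A') cB (conj (iA x I Ax) (dAB x Ax)).
  exists e; split=> // y /He[/intr_sub A'y nB] [//|[Zy]].
  by apply: dis => //; apply: AU.
have BS x : B x -> intr (fun y => ~ S y) x.
  move=> Bx; have [e [e0 He]] := opn_and (@opn_intr B') cA (conj (iB x I Bx) (fun a => dAB x a Bx)).
  exists e; split=> // y /He[/intr_sub B'y nA] [//|[Zy Uy]].
  by apply: (dis y Zy Uy); apply: BV.
have UT x : Z x -> U x -> intr (fun y => ~ T y) x.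
  move=> Zx Ux; have nB : ~ B x by move/(iB x I)/intr_sub/(BV x Zx); apply: dis.
  have [e [e0 He]] := opn_and oU cB (conj Ux nB).
  exists e; split=> // y /He[Uy nBy] [//|[Zy]]; exact: dis.
have VS x : Z x -> V x -> intr (fun y => ~ S y) x.
  move=> Zx Vx; have nA : ~ A x.
    by move/(iA x I)/intr_sub/(AU x Zx) => Ux; apply: dis Vx.
  have [e [e0 He]] := opn_and oV cA (conj Vx nA).
  by exists e; split=> // y /He[Vy nAy] [//|[Zy Uy]]; apply: dis Vy.
have SU x : S x -> 1 * dset x S < 1 * dset x T.
  move=> Sx; rewrite (dset_in Sx).
  have: 0 < dset x T by apply: far_gt0; case: Sx => [/AT//|[Zx]]; apply: UT.
  by lra.
have TV x : T x -> 1 * dset x T < 1 * dset x S.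
  move=> Tx; rewrite (dset_in Tx).
  have: 0 < dset x S by apply: far_gt0; case: Tx => [/BS//|[Zx]]; apply: VS.
  by lra.
exists (fun x => 1 * dset x S < 1 * dset x T), (fun x => 1 * dset x T < 1 * dset x S); split.
- by apply: opn_dset_lt; lra.
- by apply: opn_dset_lt; lra.
- by move=> x; lra.
- by move=> x Zx; case: (cov x Zx) => H; [left; apply: SU|right; apply: TV]; right.
- by split=> x Hx; [apply: SU|apply: TV]; left.
Qed.

(** The index is shifted as in [ind_le]: [n] sets correspond to dimension at most n - 1. *)
Definition zd_cover n Y := exists Zs : nat -> X -> Prop,
  (forall i, (i < n)%N -> zd (Zs i)) /\ forall x, Y x -> exists i, (i < n)%N /\ Zs i x.

Lemma zd_cover_sub n Y Y' : (forall x, Y' x -> Y x) -> zd_cover n Y -> zd_cover n Y'.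
Proof. by move=> sub [Zs [zZ cov]]; exists Zs; split=> // x /sub/cov. Qed.

(** The pieces [C i] are first made disjoint. The [p]-th zero-dimensional sets of all the pieces
    then unite to one zero-dimensional set, by [zd_sum]. *)
Lemma zd_cover_sum (I : countType) (C : I -> X -> Prop) n Y : (forall i, cls (C i)) ->
  (forall x, Y x -> exists i, C i x) -> (forall i, zd_cover n (fun x => Y x /\ C i x)) ->
  zd_cover n Y.
Proof.
move=> cC cov dC; have [Zs HZs] := choice dC.
pose before (i : I) x := exists j, (pickle j < pickle i)%N /\ C j x.
have cls_before i : cls (before i).
  apply: opn_iff (opn_all_below (n := pickle i) cC) => x; split.
    by move=> H [j [lt Cj]]; apply: (H j lt).
  by move=> H j lt Cj; apply: H; exists j.
pose G (i : I) x := C i x /\ ~ before i x.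
have Gcov x : Y x -> exists i, G i x.
  move=> Yx; have ex : exists n, truth (exists i, pickle i = n /\ C i x).
    have [i Ci] := cov x Yx; exists (pickle i).
    by rewrite /truth; case: excluded_middle_informative => // -[]; exists i.
  case: (ex_minnP ex) => p; rewrite {1}/truth.
  case: excluded_middle_informative => // -[i [ip Ci]] _ minp.
  exists i; split=> // -[j [ji Cj]]; have := minp (pickle j); rewrite /truth.
  by case: excluded_middle_informative => [_ /(_ isT)|[]]; [rewrite -ip leqNgt ji|exists j].
have Gdis x i j : G i x -> G j x -> i = j.
  move=> [Ci ni] [Cj nj]; have [lt|gt|/(pcan_inj pickleK)//] := ltngtP (pickle i) (pickle j).
    by case: nj; exists i.
  by case: ni; exists j.
(* [C i] minus the earlier members is a countable union of closed sets, those at distance at least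
   1/(k+1) from the earlier members. *)
pose E (ik : I * nat) x := C ik.1 x /\ / INR ik.2.+1 <= dset x (before ik.1).
exists (fun p x => exists i, [/\ G i x, Y x & Zs i p x]); split.
  move=> p pn; apply: (@zd_sum _ E).
  - move=> [i k]; apply: cls_and; first exact: cC.
    rewrite /snd /fst; move: (/ INR k.+1) => w x /Rnot_le_lt lt.
    exists (w - dset x (before i)); split=> [|y xy]; first lra.
    by have := dset_lip y x (before i); rewrite pdistC; lra.
  - move=> x [i [[Ci nb] Yx Zx]].
    have [e [e0 He]] := cls_before i x nb; have d0 := dset_out e0 He.
    have [k [kd k0]] := archimed_cor1 _ d0; exists (i, k); split; first by [].
    apply: Rle_trans (Rlt_le _ _ kd); apply: Rinv_le_contravar.
      exact: lt_0_INR.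
    by apply: le_INR; apply/leP; apply: leqnSn.
  - move=> [i k]; apply: (@zd_sub (Zs i p)); last by case: (HZs i) => H _; apply: H.
    move=> x [[j [Gj Yx Zx]] [Ci dx]]; rewrite /fst /snd in Ci dx.
    rewrite (_ : i = j) //; apply: (@Gdis x) => //; split=> // bx.
    have : 0 < / INR k.+1 by apply: Rinv_0_lt_compat; apply: lt_0_INR; lia.
    by move: dx; rewrite (dset_in bx); set w := / _; rewrite /w; lra.
move=> x Yx; have [i Gi] := Gcov x Yx; have [_ H] := HZs i.
by have [|p [pn Zp]] := H x; [case: Gi|exists p; split=> //; exists i].
Qed.

(** The neighbourhood is chosen with a boundary missing the last set [Zs n], so the [n] others cover
    this boundary and induction applies. *)
Lemma ind_le_of_zd_cover n A : zd_cover n A -> ind_le opn n A.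
Proof.
elim: n A => [|n IH] A [Zs [zZ cov]] /=; first by move=> x /cov[i []].
move=> x Ax U0 [O [oO UO]] /(UO x Ax) Ox.
have [e [e0 He]] := oO x Ox.
have [||||U [V [oU oV dUV ZUV [xU OV]]]] :=
    @separate_off_zd (fun y => pdist x y <= e / 2) (fun y => ~ O y) (Zs n).
- exact: cls_ball.
- exact: opn_not_cls.
- by move=> y xy; apply; apply: He; lra.
- exact: zZ.
exists (fun y => ~ V y); split; last split; last split.
- by exists (fun y => ~ V y); split=> //; apply: opn_not_cls.
- by move=> y Ay nV; apply/(UO y Ay); apply: NNPP => /OV.
- split=> //; exists U; split; last split.
  + by exists U.
  + by apply: xU; rewrite pdistxx; lra.
  + by move=> y _ Uy; apply: dUV.
apply: IH; exists Zs; split=> [i lt|y [[Ay cy] ni]]; first by apply: zZ; apply: ltnW.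
have nV : ~ V y.
  move=> Vy; have [|z [_ [Vz]]] := cy V _ Vy; last by [].
  by exists V.
have nU : ~ U y.
  move=> Uy; apply: ni; split=> //; exists U; split; first by exists U.
  by split=> // z _; apply: dUV.
have [i [lt Zi]] := cov y Ay; exists i; split=> //.
move: lt; rewrite ltnS leq_eqVlt => /orP[/eqP ei|//].
by rewrite ei in Zi; case: (ZUV y Zi).
Qed.

Lemma zd_cover0 n : zd_cover n (fun=> False).
Proof. by exists (fun _ _ => False); split=> // i _ x e []. Qed.

(** Countably many neighbourhoods with small boundaries suffice. The union [Y] of their boundaries
    is covered by [n] sets through induction and the sum theorem; off [Y] these neighbourhoods are
    clopen, so the rest of [A] is the last zero-dimensional set. *)
Lemma zd_cover_of_ind_le n A : ind_le opn n A -> zd_cover n A.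
Proof.
elim: n A => [|n IH] A /=.
  by move=> H; exists (fun _ _ => False); split=> // x /H.
move=> indA.
pose bd := boundaryIn X opn A.
pose fine V := closedIn X opn A V /\ ind_le opn n (bd V).
(* Countability comes from fixing one neighbourhood for each pair of basic sets between which one
   fits. *)
pose good (b : basis_index * basis_index) V :=
  [/\ fine V, forall y, A y -> V y -> basic b.2 y &
    forall y, A y -> basic b.1 y -> interiorIn X opn A V y].
have [sel Hsel] : exists sel, forall b, (exists V, good b V) -> good b (sel b).
  apply: (choice (P := fun b V => (exists V, good b V) -> good b V)) => b.
  by have [[V gV]|H] := classic (exists V, good b V); [exists V|exists (fun=> True) => /H].
pose B b x := good b (sel b) /\ bd (sel b) x.
pose Y x := exists b, B b x.
(* The boundary is closed only relative to [A], whereas the sum theorem asks for closed sets of the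
   whole space. Its closure adds no point of [A], which is [CB]. *)
pose C b x := ~ intr (fun y => ~ B b y) x.
have CB b x : A x -> C b x -> B b x.
  move=> Ax nint; have gb : good b (sel b).
    apply: NNPP => ng; apply: nint; exists 1; split; first lra.
    by move=> y _ [].
  split=> //; split.
    split=> // W [O [oO WO]] /(WO x Ax) Ox; apply: NNPP => H; apply: nint.
    have [e [e0 He]] := oO x Ox; exists e; split=> // y /He Oy [_ [[Ay cy] _]].
    have [|/= z [Az [Oz Vz]]] := cy O _ Oy; first by exists O.
    by apply: H; exists z; split=> //; split=> //; apply/(WO z Az).
  move=> [_ [W [[O [oO WO]] [/(WO x Ax) Ox WV]]]]; apply: nint.
  have [e [e0 He]] := oO x Ox; exists e; split=> // y /He Oy [_ [[Ay _] ni]].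
  by apply: ni; split=> //; exists W; split; [exists O|split=> //; apply/(WO y Ay)].
have YA x : Y x -> A x by case=> b [_ [[]]].
have [Zs [zZ cov]] : zd_cover n Y.
  apply: (@zd_cover_sum _ C).
  - by move=> b; apply: opn_not_cls; apply: opn_intr.
  - by move=> x [b Bx]; exists b => /intr_sub; apply.
  - move=> b; have [gb|ng] := classic (good b (sel b)).
      apply: (@zd_cover_sub _ (bd (sel b))); last by apply: IH; case: gb => -[].
      by move=> x [/YA Ax /(CB b x Ax)[]].
    apply: zd_cover_sub (zd_cover0 n) => x [/YA Ax /(CB b x Ax)[//]].
exists (fun i => if (i < n)%N then Zs i else fun x => A x /\ ~ Y x); split; last first.
  move=> x Ax; have [Yx|nYx] := classic (Y x); last by exists n; rewrite ltnn.
  by have [i [lt Zi]] := cov x Yx; exists i; rewrite lt; split=> //; apply: ltnW.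
move=> i _; case: ifP => [/zZ//|_] x e [Ax nYx] e0.
have [b2 [xb2 Hb2]] := basic_small x e0.
have ob2 : openIn X opn A (basic b2) by exists (basic b2); split=> //; apply: opn_basic.
have [V [cV [VU [iV dV]]]] := indA x Ax _ ob2 xb2.
have [_ [W [[O [oO WO]] [Wx WV]]]] := iV.
have [e' [e'0 He']] := oO x (proj1 (WO x Ax) Wx).
have [b1 [xb1 Hb1]] := basic_small x e'0.
have gV : good (b1, b2) V.
  split=> // y Ay /= /Hb1/He' Oy; split=> //; exists W; split; first by exists O.
  by split=> //; apply/(WO y Ay).
have {V cV VU iV dV W O oO WO Wx WV e' e'0 He' Hb1 gV} gs :=
  Hsel (b1, b2) (ex_intro _ V gV).
set V := sel (b1, b2) in gs.
have [[[C0 [cC0 VC0]] _] /= VU iV] := gs.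
(* An ambient open set whose trace on [A] is the interior of [V]. Off [Y] a point of [V] is
   interior, so [C0] and the complement of [N] are complementary there. *)
pose N y := exists O, [/\ opn O, O y & forall z, A z -> O z -> V z].
have oN : opn N.
  apply: opn_ex => O y [oO Oy H]; have [d [d0 Hd]] := oO y Oy.
  by exists d; split=> // z /Hd.
have NV y : A y -> N y -> V y by move=> Ay [O [oO Oy]]; apply.
exists C0, (fun y => ~ N y); split=> //.
- exact: opn_not_cls.
- move=> y [Ay _]; have [Ny|] := classic (N y); last by right.
  by left; apply/(VC0 y Ay); apply: NV.
- move=> y [Ay nYy] /(VC0 y Ay) Vy nN; apply: nYy; exists (b1, b2); split=> //; split.
    by split=> // W' _ W'y; exists y.
  move=> [_ [W [[O [oO WO]] [/(WO y Ay) Oy WV]]]]; apply: nN; exists O; split=> //.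
  by move=> z Az /(WO z Az); apply: WV.
split.
  apply/(VC0 x Ax); have [_ [W [_ [Wx WV]]]] := iV x Ax xb1; exact: WV.
by move=> y [Ay _] /(VC0 y Ay)/(VU y Ay)/Hb2.
Qed.
End Pseudometric.

(** The topology of [A] is pulled back along [g], so neighbourhoods pull back and the boundary of a
    preimage lies over the boundary; induction takes these boundaries as the new [A] and [B]. *)
Lemma ind_le_embed (X Y : Type) (T : (X -> Prop) -> Prop) (T' : (Y -> Prop) -> Prop)
    (g : X -> Y) n (A : X -> Prop) (B : Y -> Prop) :
  (forall O U, (forall x, O x <-> U x) -> T O -> T U) ->
  (forall x, A x -> B (g x)) ->
  (forall O', T' O' -> openIn X T A (fun x => O' (g x))) ->
  (forall O, T O -> exists O', T' O' /\ forall x, A x -> (O x <-> O' (g x))) ->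
  ind_le T' n B -> ind_le T n A.
Proof.
move=> Text; elim: n A B => [|n IH] A B AB cont emb /=.
  by move=> H x /AB/H.
move=> indB x Ax U [O [TO UO]] /(UO x Ax) Ox.
have [O' [TO' OO']] := emb O TO.
have [|V [[C [TC VC]] [VO [[_ [W [[O2 [TO2 WO2]] [Wx WV]]]] dV]]]] :=
  indB (g x) (AB x Ax) O' _ (proj1 (OO' x Ax) Ox).
  by exists O'.
have pull Q : openIn Y T' B Q -> openIn X T A (fun x => Q (g x)).
  move=> [P [TP QP]]; have [P2 [TP2 PP2]] := cont P TP; exists P2; split=> // y Ay.
  by rewrite (QP _ (AB y Ay)) PP2.
exists (fun y => V (g y)); split; last split; last split.
- have [P [TP CP]] := cont _ TC; exists (fun y => ~ P y); split.
    by apply: Text TP => y; split=> [Py|/NNPP//]; apply.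
  move=> y Ay; rewrite (VC _ (AB y Ay)) -(CP y Ay); split=> [Cy|/NNPP//]; exact.
- by move=> y Ay /(VO _ (AB y Ay)) /(OO' y Ay) /(UO y Ay).
- split=> //; exists (fun y => W (g y)); split; last by split=> // y /AB; apply: WV.
  by apply: pull; exists O2.
apply: IH dV => [y [[Ay cy] ni]|O1 /cont[P [TP PP]]|O1 /emb[P [TP PP]]].
- split.
    split; first exact: AB.
    by move=> W1 /pull oW1 /(cy _ oW1)[z [Az [Wz Vz]]]; exists (g z); split=> //; apply: AB.
  move=> [_ [W1 [/pull oW1 [W1y W1V]]]]; apply: ni; split=> //.
  by exists (fun z => W1 (g z)); split=> //; split=> // z /AB; apply: W1V.
- by exists P; split=> // y [[Ay _] _]; apply: PP.
- by exists P; split=> // y [[Ay _] _]; apply: PP.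
Qed.

(** * Groups spanned by frames *)

HB.instance Definition _ := Monoid.isComLaw.Build R 0 Rplus
  (fun x y z => esym (Rplus_assoc x y z)) Rplus_comm Rplus_0_l.
HB.instance Definition _ := Monoid.isMulLaw.Build R 0 Rmult Rmult_0_l Rmult_0_r.
HB.instance Definition _ := Monoid.isAddLaw.Build R Rmult Rplus
  Rmult_plus_distr_r Rmult_plus_distr_l.

Notation "\rsum_ ( c : T ) F" := (\big[Rplus/0]_(c : T) F)
  (at level 41, F at level 41, c at level 50).

Definition isint (r : R) := exists n : Z, r = IZR n.

Lemma nearest_int r : exists n : Z, Rabs (r - IZR n) <= / 2.
Proof.
have [a b] := archimed (r - / 2).
by exists (up (r - / 2)); apply: Rabs_le; lra.
Qed.

Lemma isint_small r : isint r -> Rabs r < 1 -> r = 0.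
Proof.
move=> [n ->] /Rabs_def2[/(lt_IZR _ 1) a].
by rewrite -(opp_IZR 1) => /lt_IZR b; have -> : n = 0%Z by lia.
Qed.

Section Frames.
Variable I : finType.
Implicit Types (x y v : I -> R) (A : I * I -> R) (tau : I -> option bool) (H : (I -> R) -> Prop).

Definition mv A y : I -> R := fun i => \rsum_(c : I) (A (i, c) * y c).

Definition unitv (c : I) : I -> R := fun i => if i == c then 1 else 0.

Lemma mv_unit A c i : mv A (unitv c) i = A (i, c).
Proof.
rewrite /mv (bigD1 c) //= big1 /unitv => [|j /negbTE->]; last by rewrite Rmult_0_r.
by rewrite eqxx; lra.
Qed.

Lemma mv_plus A x y : mv A (vplus x y) = vplus (mv A x) (mv A y).
Proof.
apply: functional_extensionality => i; rewrite /mv /vplus -big_split.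
by apply: eq_bigr => c _; rewrite /= Rmult_plus_distr_l.
Qed.

Lemma mv_scale A t y : mv A (vscale t y) = vscale t (mv A y).
Proof.
apply: functional_extensionality => i; rewrite /mv /vscale big_distrr.
by apply: eq_bigr => c _ /=; ring.
Qed.

Lemma mv0 A : mv A (fun=> 0) = fun=> 0.
Proof.
by apply: functional_extensionality => i; rewrite /mv big1 // => c _; rewrite Rmult_0_r.
Qed.

Lemma vminusE x y : vminus x y = vplus x (vscale (-1) y).
Proof. by apply: functional_extensionality => i; rewrite /vminus /vplus /vscale; ring. Qed.

Lemma mv_minus A x y : mv A (vminus x y) = vminus (mv A x) (mv A y).
Proof. by rewrite !vminusE mv_plus mv_scale. Qed.

Lemma sum_abs_le (T : finType) (F : T -> R) : Rabs (\rsum_(c : T) F c) <= \rsum_(c : T) Rabs (F c).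
Proof.
elim/big_ind2: _ => [|a b c d ab cd|c _]; rewrite ?Rabs_R0; try lra.
by apply: Rle_trans (Rabs_triang _ _) _; lra.
Qed.

Lemma sum_le (T : finType) (F G : T -> R) : (forall c, F c <= G c) ->
  \rsum_(c : T) F c <= \rsum_(c : T) G c.
Proof. by move=> FG; elim/big_ind2: _ => [|a b c d ab cd|c _]; try lra; apply: FG. Qed.

Lemma sum_const (T : finType) (r : R) : \rsum_(c : T) r = INR #|T| * r.
Proof.
rewrite big_const; elim: #|T| => [|n IH] /=; first lra.
by rewrite IH -/(INR n.+1) S_INR; lra.
Qed.

Lemma nrm_mv_le A y e : 0 <= e -> (forall p, Rabs (A p) <= e) ->
  nrm (mv A y) <= INR #|I| * e * nrm y.
Proof.
move=> e0 Ae; have n0 := pos_INR #|I|; have y0 := nrm_ge0 y.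
apply: nrm_le => [|i]; first by apply: Rmult_le_pos => //; apply: Rmult_le_pos.
apply: Rle_trans (sum_abs_le _) _.
rewrite Rmult_assoc -sum_const; apply: sum_le => c; rewrite Rabs_mult.
by apply: Rmult_le_compat => //; try exact: Rabs_pos; apply: nrm_coord.
Qed.

(* The kinds [Some true], [Some false], [None] of a column stand for a coefficient ranging
   over the reals, over the integers, and for an unused column. *)
Definition coef tau y := forall c, match tau c with
  Some true => True | Some false => isint (y c) | None => y c = 0 end.

Definition supported tau y := forall c, tau c = None -> y c = 0.

Definition frame_group tau A x := exists y, coef tau y /\ x = mv A y.

(** A reduced echelon form: the unit rows fix the basis of the linear part and also the
    representatives of the integer columns modulo that part. *)
Definition normal_form tau A :=
  (forall i c, tau i = Some true -> A (i, c) = unitv i c) /\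
  (forall i c, tau c = None -> A (i, c) = 0).

(** Quantitative independence of the used columns. *)
Definition bounded_below C tau A := forall y, supported tau y -> nrm y <= C * nrm (mv A y).

Definition subgroup H := [/\ H (fun=> 0), forall x y, H x -> H y -> H (vplus x y) &
  forall x, H x -> H (fun j => - x j)].

Lemma coef_supported tau y : coef tau y -> supported tau y.
Proof. by move=> Hy c tc; have := Hy c; rewrite tc. Qed.

Lemma subgroup_minus H x y : subgroup H -> H x -> H y -> H (vminus x y).
Proof. by move=> [_ add opp] Hx Hy; apply: (add _ _ Hx (opp _ Hy)). Qed.

Lemma subgroup_int H x n : subgroup H -> H x -> H (vscale (IZR n) x).
Proof.
move=> [H0 add opp] Hx.
have nat_mul (k : nat) : H (vscale (INR k) x).
  elim: k => [|k IH]; first by rewrite (_ : vscale _ _ = fun=> 0) //;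
    apply: functional_extensionality => i; rewrite /vscale /=; ring.
  rewrite (_ : vscale _ _ = vplus (vscale (INR k) x) x); first exact: add.
  by apply: functional_extensionality => i; rewrite /vscale /vplus S_INR; ring.
have [ge|lt] := Z_le_gt_dec 0 n.
  by rewrite -(Z2Nat.id n) // -INR_IZR_INZ.
rewrite (_ : vscale _ _ = fun i => - vscale (INR (Z.to_nat (- n))) x i); first exact: opp.
apply: functional_extensionality => i; rewrite /vscale INR_IZR_INZ Z2Nat.id; last lia.
by rewrite opp_IZR; ring.
Qed.

Lemma subgroup_mv H A y : subgroup H ->
  (forall c, H (vscale (y c) (fun i => A (i, c)))) -> H (mv A y).
Proof.
move=> [H0 add _] Hc.
have -> : mv A y = fun i => \big[Rplus/0]_(c <- index_enum I) (A (i, c) * y c) by [].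
elim: (index_enum I) => [|c L IH].
  by rewrite (_ : (fun _ => _) = fun=> 0) //; apply: functional_extensionality => i; rewrite big_nil.
rewrite (_ : (fun _ => _) = vplus (vscale (y c) (fun i => A (i, c)))
  (fun i => \big[Rplus/0]_(c <- L) (A (i, c) * y c))); first exact: add.
by apply: functional_extensionality => i; rewrite big_cons /vplus /vscale; ring.
Qed.

Lemma coef_subgroup tau : subgroup (coef tau).
Proof.
split=> [c|x y Hx Hy c|x Hx c].
- by case: (tau c) => [[]|] //; exists 0%Z.
- have := Hx c; have := Hy c; rewrite /vplus; case: (tau c) => [[]|] //.
    by move=> [n ->] [m ->]; exists (m + n)%Z; rewrite plus_IZR.
  by move=> -> ->; ring.
- have := Hx c; case: (tau c) => [[]|] //; last by move=> ->; ring.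
  by move=> [n ->]; exists (- n)%Z; rewrite opp_IZR.
Qed.

Lemma frame_subgroup tau A : subgroup (frame_group tau A).
Proof.
have [c0 cp cn] := coef_subgroup tau.
split=> [|x x' [y [cy ->]] [y' [cy' ->]]|x [y [cy ->]]].
- by exists (fun=> 0); rewrite mv0.
- by exists (vplus y y'); rewrite mv_plus; split=> //; apply: cp.
- exists (fun c => - y c); split; first exact: cn.
  have -> : (fun c => - y c) = vscale (-1) y.
    by apply: functional_extensionality => i; rewrite /vscale; ring.
  by rewrite mv_scale; apply: functional_extensionality => i; rewrite /vscale; ring.
Qed.

Lemma coef_unit tau c : tau c <> None -> coef tau (unitv c).
Proof.
move=> tc i; rewrite /unitv; have [->|_] := eqVneq i c.
  by case: (tau c) tc => [[]|] // _; exists 1%Z.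
by case: (tau i) => [[]|] //; exists 0%Z.
Qed.

Lemma frame_column tau A c : tau c <> None -> frame_group tau A (fun i => A (i, c)).
Proof.
move=> /(@coef_unit tau c) cu; exists (unitv c); split=> //.
by apply: functional_extensionality => i; rewrite mv_unit.
Qed.

Definition kind_at tau j k : I -> option bool := fun c => if c == j then k else tau c.

(** * Adjoining one generator to a frame *)

Section Extend.
Variables (tau : I -> option bool) (A : I * I -> R) (j : I) (k : option bool)
  (v kappa : I -> R) (C : R).
Hypotheses (colj : forall i, A (i, j) = 0) (rowj : forall c, A (j, c) = 0)
  (vj : v j <> 0) (kj : kappa j = 1) (C0 : 0 < C) (bbA : bounded_below C tau A).

(** The zero column [j] becomes [v], and every other column [c] is corrected by [kappa c] times [v].
    This lifts a frame of a quotient by [v] and adds [v] to it. *)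
Definition extend : I * I -> R := fun p => A p + kappa p.2 * v p.1.

Lemma mv_extend y :
  mv extend y = vplus (mv A (upd y j 0)) (vscale (\rsum_(c : I) (kappa c * y c)) v).
Proof.
apply: functional_extensionality => i; rewrite /mv /vplus /vscale big_distrl -big_split.
apply: eq_bigr => c _; rewrite /extend /upd /=.
by have [->|_] := eqVneq c j; rewrite ?colj; ring.
Qed.

Lemma mv_row y : mv A y j = 0.
Proof. by rewrite /mv big1 // => c _; rewrite rowj Rmult_0_l. Qed.

Lemma sum_upd y t : \rsum_(c : I) (kappa c * upd y j t c) =
  t + \rsum_(c : I) (kappa c * upd y j 0 c).
Proof.
rewrite (bigD1 j) // [in RHS](bigD1 j) //= !upd_same kj.
rewrite (eq_bigr (fun c => kappa c * upd y j 0 c)) => [|c cj]; last by rewrite !upd_other.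
ring.
Qed.

(** Row [j] of [A] vanishes, so coordinate [j] of the image determines the multiple [s] of [v] in
    it. Subtracting that multiple leaves an image under [A], which controls the other coefficients;
    then [s] controls [y j]. *)
Lemma extend_bounded_below : exists C', 0 < C' /\ bounded_below C' (kind_at tau j k) extend.
Proof.
set a := / Rabs (v j); have a0 : 0 < a by apply: Rinv_0_lt_compat; apply: Rabs_pos_lt.
set b := C * (1 + a * nrm v); have v0 := nrm_ge0 v.
have b0 : 0 <= b by rewrite /b; apply: Rmult_le_pos; nra.
set m := \rsum_(c : I) Rabs (kappa c).
have m0 : 0 <= m.
  by rewrite /m; elim/big_ind: _ => [|? ? ? ?|? _]; try lra; apply: Rabs_pos.
(* Here [a] bounds [s], [b] the coefficients other than [y j], and [a + m * b] bounds [y j], all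
   relative to the norm of the image. *)
exists (1 + b + a + m * b); split; first by have := Rmult_le_pos _ _ m0 b0; lra.
move=> y sy; set x := mv extend y; set N := nrm x; have N0 : 0 <= N := nrm_ge0 x.
set y' := upd y j 0; set s := \rsum_(c : I) (kappa c * y c).
have xE : x = vplus (mv A y') (vscale s v) by apply: mv_extend.
have sa : Rabs s <= a * N.
  have xj : x j = s * v j by rewrite xE /vplus /vscale mv_row; ring.
  have -> : s = x j * / v j by rewrite xj; field.
  rewrite Rabs_mult Rabs_inv -/a Rmult_comm.
  by apply: Rmult_le_compat_l; [lra|apply: nrm_coord].
have sy' : supported tau y'.
  move=> c tc; rewrite /y' /upd; have [//|cj] := eqVneq c j.
  by apply: sy; rewrite /kind_at (negbTE cj).
have by' : nrm y' <= b * N.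
  have := bbA sy'; have -> : mv A y' = vminus x (vscale s v).
    by apply: functional_extensionality => i; rewrite xE /vminus /vplus; ring.
  have := nrm_add x (vscale (-1) (vscale s v)); rewrite -vminusE.
  have := nrm_scale_le (-1) (vscale s v); have := nrm_scale_le s v.
  have -> : Rabs (-1) = 1 by rewrite Rabs_Ropp Rabs_R1.
  rewrite -/N /b => h1 h2 h3 h4; have h6 := Rmult_le_compat_r _ _ _ v0 sa.
  have h5 : nrm (vminus x (vscale s v)) <= (1 + a * nrm v) * N by lra.
  by have := Rmult_le_compat_l _ _ _ (Rlt_le _ _ C0) h5; lra.
have ky' : Rabs (\rsum_(c : I) (kappa c * y' c)) <= m * (b * N).
  apply: Rle_trans (sum_abs_le _) _; rewrite /m big_distrl; apply: sum_le => c /=.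
  rewrite Rabs_mult; apply: Rmult_le_compat_l; first exact: Rabs_pos.
  exact: Rle_trans (nrm_coord _ _) by'.
have yj : Rabs (y j) <= a * N + m * (b * N).
  have -> : y j = s + - \rsum_(c : I) (kappa c * y' c).
    have := sum_upd y (y j); have -> : upd y j (y j) = y.
      by apply: functional_extensionality => c; rewrite /upd; case: eqP => [->|].
    by rewrite -/s -/y'; lra.
  by apply: Rle_trans (Rabs_triang _ _) _; rewrite Rabs_Ropp; lra.
have mb := Rmult_le_pos _ _ m0 (Rmult_le_pos _ _ b0 N0).
have bN := Rmult_le_pos _ _ b0 N0; have aN := Rmult_le_pos _ _ (Rlt_le _ _ a0) N0.
apply: nrm_le => [|c]; first by lra.
have [->|cj] := eqVneq c j; first by lra.
have := nrm_coord y' c; have -> : y' c = y c by apply: upd_other.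
by lra.
Qed.
End Extend.

Definition has_frame (S : {set I}) H := exists tau A C, [/\ normal_form tau A, 0 < C,
  bounded_below C tau A, forall i, i \notin S -> tau i = None &
  forall x, H x <-> frame_group tau A x].

Definition vclosed H := vopen (fun x => ~ H x).

Lemma nonzero_coord x : x <> (fun=> 0) -> exists j, x j <> 0.
Proof.
move=> nx; apply: NNPP => nj; apply: nx; apply: functional_extensionality => j.
by apply: NNPP => xj; apply: nj; exists j.
Qed.

(** [H] is the sum of the line and of [H'], its elements with vanishing coordinate [j]. [H'] is
    supported on one coordinate less, which frees column [j]. *)
Lemma frame_line H (S : {set I}) u j : subgroup H -> vclosed H ->
  (forall x i, H x -> i \notin S -> x i = 0) -> (forall t, H (vscale t u)) -> u j = 1 ->
  (forall H', subgroup H' -> vclosed H' -> (forall x i, H' x -> i \notin S :\ j -> x i = 0) ->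
    has_frame (S :\ j) H') -> has_frame S H.
Proof.
move=> sH cH HS uH uj IH.
have jS : j \in S.
  apply: contraT => /(HS _ _ (uH 1)); rewrite /vscale uj; lra.
pose H' x := H x /\ x j = 0.
have sH' : subgroup H'.
  have [H0 add opp] := sH; split=> [|x y [Hx xj] [Hy yj]|x [Hx xj]].
  - by split.
  - by split; [apply: add|rewrite /vplus; lra].
  - by split; [apply: opp|lra].
have [|x i [Hx xj]|tau [A [C [nfA C0 bbA tauS HA]]]] := IH H' sH'.
- move=> x nx; have [/cH[e [e0 He]]|/NNPP Hx] := classic (~ H x).
    by exists e; split=> // y /He nH [].
  have xj : x j <> 0 by move=> xj; apply: nx.
  exists (Rabs (x j)); split; first exact: Rabs_pos_lt.
  by move=> y /(_ j) lt [_ yj]; move: lt; rewrite yj Rminus_0_l Rabs_Ropp; lra.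
- by rewrite !inE negb_and negbK => /orP[/eqP->//|]; apply: HS.
have tj : tau j = None by apply: tauS; rewrite !inE eqxx.
have rowj c : A (j, c) = 0.
  have [/(proj2 nfA j)//|tc] := classic (tau c = None).
  by have [_] := proj2 (HA _) (frame_column A tc).
have colj i : A (i, j) = 0 by apply: (proj2 nfA).
(* Gaussian elimination: subtracting these multiples of the line columns from [u] clears the rows of
   the line columns, as the normal form requires of the new column [w]. *)
pose yu c := if tau c is Some true then u c else 0.
have yuH t : H' (vscale t (mv A yu)).
  apply/HA; exists (vscale t yu); rewrite mv_scale; split=> // c.
  rewrite /vscale /yu; case: (tau c) => [[]|] //; last by rewrite Rmult_0_r.
  by exists 0%Z; rewrite Rmult_0_r.
pose w := vminus u (mv A yu).
have wj : w j = 1 by rewrite /w /vminus uj (mv_row rowj); ring.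
have wline c : tau c = Some true -> w c = 0.
  move=> tc; rewrite /w /vminus; have -> : mv A yu c = u c; last by ring.
  rewrite /mv (bigD1 c) //= big1 => [|i ic].
    by rewrite (proj1 nfA _ _ tc) /unitv eqxx /yu tc; lra.
  by rewrite (proj1 nfA _ _ tc) /unitv (negbTE ic) Rmult_0_l.
have wH t : H (vscale t w).
  have -> : vscale t w = vminus (vscale t u) (vscale t (mv A yu)).
    by apply: functional_extensionality => i; rewrite /vscale /w /vminus; ring.
  by apply: subgroup_minus => //; case: (yuH t).
have wj0 : w j <> 0 by rewrite wj; lra.
pose kappa := unitv j.
have kj : kappa j = 1 by rewrite /kappa /unitv eqxx.
have [C' [C'0 bbC']] := extend_bounded_below (Some true) colj rowj wj0 kj C0 bbA.
have sk y : \rsum_(c : I) (kappa c * y c) = y j.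
  rewrite (bigD1 j) //= big1 => [|c cj]; first by rewrite kj; lra.
  by rewrite /kappa /unitv (negbTE cj) Rmult_0_l.
have mvE y := mv_extend w kappa colj y.
exists (kind_at tau j (Some true)), (extend A w kappa), C'; split=> //.
- split=> i c; rewrite /kind_at /extend /=.
    have [->|ij] := eqVneq i j; first by rewrite rowj wj /kappa /unitv; lra.
    by move=> ti; rewrite (proj1 nfA _ _ ti) wline //; lra.
  have [//|cj] := eqVneq c j => tc; rewrite (proj2 nfA _ _ tc) /kappa /unitv (negbTE cj); lra.
- move=> i iS; rewrite /kind_at; have [e|_] := eqVneq i j; first by rewrite e jS in iS.
  by apply: tauS; rewrite !inE negb_and iS orbT.
move=> x; split=> [Hx|[y [cy ->]]].
  have : H' (vminus x (vscale (x j) w)).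
    by split; [apply: subgroup_minus|rewrite /vminus /vscale wj; ring].
  move/HA=> [y [cy xE]]; have yj : y j = 0 by have := cy j; rewrite tj.
  exists (upd y j (x j)); split.
    move=> c; rewrite /kind_at /upd; have [//|_] := eqVneq c j; exact: cy.
  rewrite mvE sk upd_same upd_upd (_ : upd y j 0 = y).
    rewrite -xE; apply: functional_extensionality => i; rewrite /vplus /vminus; ring.
  by apply: functional_extensionality => c; rewrite /upd; case: eqP => // ->.
rewrite mvE sk; have [_ add _] := sH; apply: add => //.
suff : H' (mv A (upd y j 0)) by case.
apply/HA; exists (upd y j 0); split=> // c; have := cy c; rewrite /kind_at /upd.
by have [->|//] := eqVneq c j; rewrite tj.
Qed.
Definition discrete H := exists m, 0 < m /\ forall x, H x -> nrm x < m -> x = fun=> 0.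

Lemma nrm_gt0 x : x <> (fun=> 0) -> 0 < nrm x.
Proof.
by move=> nx; have := nrm_ge0 x; case: (Rle_lt_or_eq_dec _ _ (nrm_ge0 x)) => // e; case: nx;
  apply: nrm_zero_eq; lra.
Qed.

(** [m] is the infimum of the nonzero lengths, positive by discreteness. The factor 3/2 is small
    enough for later: half of [nrm v] plus m/4 is still below [m]. *)
Lemma almost_shortest H : subgroup H -> discrete H -> (exists x, H x /\ x <> (fun=> 0)) ->
  exists v m, [/\ H v, v <> (fun=> 0), 0 < m, nrm v < 3 / 2 * m &
    forall x, H x -> nrm x < m -> x = fun=> 0].
Proof.
move=> sH [m0 [m00 Hm0]] [x0 [Hx0 nx0]].
pose S r := exists x, [/\ H x, x <> (fun=> 0) & r = nrm x].
have neS : exists r, S r by exists (nrm x0), x0.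
have S0 r : S r -> 0 <= r by move=> [x [_ _ ->]]; apply: nrm_ge0.
pose m := inf S.
have m0m : m0 <= m.
  apply: (le_inf neS S0) => r [x [Hx nx ->]]; apply: Rnot_lt_le => lt.
  by apply: nx; apply: Hm0.
have [|r [[v [Hv nv rv]] lt]] := inf_lt neS S0 (c := 3 / 2 * m); first by rewrite -/m; lra.
exists v, m; split=> //; try lra.
move=> x Hx lx; apply: NNPP => nx; have: m <= nrm x by apply: (inf_le neS S0); exists x.
lra.
Qed.

(* The projection along an almost shortest vector maps the group onto a discrete group again,
   because an element can be moved by multiples of [v] to within [nrm v / 2] of its projection. *)
Lemma frame_lattice H (S : {set I}) : subgroup H -> discrete H ->
  (forall x i, H x -> i \notin S -> x i = 0) -> has_frame S H.
Proof.
(* The induction also carries that there are no line columns; the condition on unit rows is then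
   vacuous. *)
suff: subgroup H -> discrete H -> (forall x i, H x -> i \notin S -> x i = 0) ->
  exists tau A C, [/\ forall c, tau c <> Some true, forall i c, tau c = None -> A (i, c) = 0,
    0 < C /\ bounded_below C tau A, forall i, i \notin S -> tau i = None &
    forall x, H x <-> frame_group tau A x].
  move=> h a b c; have [tau [A [C [nl zc [C0 bb] tS HA]]]] := h a b c.
  by exists tau, A, C; split=> //; split=> // i k /nl.
have [n] := ubnP #|S|; elim: n => // n IHn in S H * => cS sH dH HS.
have [ex|nex] := classic (exists x, H x /\ x <> (fun=> 0)); last first.
  exists (fun=> None), (fun=> 0), 1; split=> //.
    split; first lra.
    move=> y sy; rewrite (_ : y = fun=> 0); last by apply: functional_extensionality => c; apply: sy.
    by rewrite mv0 nrm0; lra.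
  move=> x; split=> [Hx|[y [cy ->]]].
    rewrite (_ : x = fun=> 0); first by case: (frame_subgroup (fun=> None) (fun=> 0)).
    by apply: NNPP => nx; apply: nex; exists x.
  rewrite (_ : y = fun=> 0); first by rewrite mv0; case: sH.
  by apply: functional_extensionality => c; apply: cy.
have [v [m [Hv nv m0 vm short]]] := almost_shortest sH dH ex.
have [j vj] := nonzero_coord nv.
have jS : j \in S by apply: contraT => /(HS _ _ Hv).
pose P x := vminus x (vscale (x j / v j) v).
have reduce x t : H (vplus x (vscale t v)) -> nrm x < m / 4 ->
    exists n : Z, vplus x (vscale (t - IZR n) v) = fun=> 0.
  move=> Hx lx; have [z tz] := nearest_int t; exists z; apply: short.
    have -> : vplus x (vscale (t - IZR z) v) = vminus (vplus x (vscale t v)) (vscale (IZR z) v).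
      by apply: functional_extensionality => i; rewrite /vplus /vminus /vscale; ring.
    by apply: subgroup_minus => //; apply: subgroup_int.
  apply: Rle_lt_trans (nrm_add _ _) _; have := nrm_scale_le (t - IZR z) v.
  by have := Rmult_le_compat_r _ _ _ (nrm_ge0 v) tz; lra.
have mult_v t : H (vscale t v) -> isint t.
  move=> Ht; have [||z tz] := @reduce (fun=> 0) t.
  - rewrite (_ : vplus _ _ = vscale t v) //.
    by apply: functional_extensionality => i; rewrite /vplus; ring.
  - by rewrite nrm0; lra.
  exists z; have := congr1 (fun x => x j) tz.
  rewrite /vplus /vscale Rplus_0_l => /Rmult_integral[|//]; lra.
pose PH x := exists h, H h /\ x = P h.
have Pj x : P x j = 0 by rewrite /P /vminus /vscale; field.
have sPH : subgroup PH.
  have [H0 add opp] := sH; split.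
  - by exists (fun=> 0); split=> //; apply: functional_extensionality => i;
      rewrite /P /vminus /vscale; field.
  - move=> _ _ [x [Hx ->]] [y [Hy ->]]; exists (vplus x y); split; first exact: add.
    by apply: functional_extensionality => i; rewrite /P /vplus /vminus /vscale; field.
  - move=> _ [x [Hx ->]]; exists (fun i => - x i); split; first exact: opp.
    by apply: functional_extensionality => i; rewrite /P /vminus /vscale; field.
have dPH : discrete PH.
  exists (m / 4); split; first lra.
  move=> _ [x [Hx ->]] lt.
  have [|z Hz] := @reduce (P x) (x j / v j) _ lt.
    rewrite (_ : vplus _ _ = x) //.
    by apply: functional_extensionality => i; rewrite /P /vplus /vminus /vscale; ring.
  have := congr1 (fun x => x j) Hz; rewrite /vplus Pj /vscale Rplus_0_l.
  case/Rmult_integral => // tz; move: Hz; rewrite tz => <-.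
  by apply: functional_extensionality => i; rewrite /vplus /vscale; ring.
have [||tau [A [C [nl zc [C0 bb] tS HA]]]] := IHn (S :\ j) PH _ sPH dPH.
- by move: cS; rewrite (cardsD1 j) jS.
- move=> _ i [x [Hx ->]]; rewrite !inE negb_and negbK => /orP[/eqP->//|iS].
  by rewrite /P /vminus /vscale (HS x i) // (HS v i) //; ring.
have tj : tau j = None by apply: tS; rewrite !inE eqxx.
have colj i : A (i, j) = 0 by apply: zc.
have rowj c : A (j, c) = 0.
  have [/zc//|tc] := classic (tau c = None).
  by have [h [_ /(congr1 (fun x => x j))]] := proj2 (HA _) (frame_column A tc); rewrite Pj.
(* A column of the projected frame is the projection of an element of [H], from which it differs by
   a multiple of [v]. *)
have lift c : exists s, tau c <> None -> H (fun i => A (i, c) + s * v i).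
  have [e|tc] := classic (tau c = None); first by exists 0.
  have [h [Hh e]] := proj2 (HA _) (frame_column A tc); exists (h j / v j) => _.
  rewrite (_ : (fun _ => _) = h) //; apply: functional_extensionality => i.
  have := congr1 (fun x => x i) e; rewrite /P /vminus /vscale /= => ->; ring.
have [kap Hkap] := choice lift.
pose kappa c := if c == j then 1 else if tau c is None then 0 else kap c.
have kj : kappa j = 1 by rewrite /kappa eqxx.
have [C' [C'0 bbC']] := extend_bounded_below (Some false) colj rowj vj kj C0 bb.
have mvE y := mv_extend v kappa colj y.
have colH c : kind_at tau j (Some false) c <> None -> H (fun i => extend A v kappa (i, c)).
  rewrite /kind_at /extend /=; have [->|cj] := eqVneq c j.
    rewrite (_ : (fun _ => _) = v) //; apply: functional_extensionality => i.
    by rewrite colj kj; ring.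
  move=> tc; have := Hkap c tc; rewrite /kappa (negbTE cj).
  by case: (tau c) tc.
have intH y : coef (kind_at tau j (Some false)) y -> H (mv (extend A v kappa) y).
  move=> cy; apply: subgroup_mv => // c; have := cy c; have := colH c.
  case e : (kind_at tau j (Some false) c) => [[]|].
  - by move: e; rewrite /kind_at; have [//|_] := eqVneq c j => e; case: (nl c).
  - by move=> /(_ ltac:(by [])) Hc [z ->]; apply: subgroup_int.
  by move=> _ ->; rewrite (_ : vscale _ _ = fun=> 0); [case: sH|
    apply: functional_extensionality => i; rewrite /vscale; ring].
exists (kind_at tau j (Some false)), (extend A v kappa), C'; split=> //.
- by move=> c; rewrite /kind_at; case: eqP.
- move=> i c; rewrite /kind_at /extend /=; have [//|cj] := eqVneq c j.
  by move=> tc; rewrite (zc _ _ tc) /kappa (negbTE cj) tc; ring.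
- move=> i iS; rewrite /kind_at; have [e|_] := eqVneq i j; first by rewrite e jS in iS.
  by apply: tS; rewrite !inE negb_and iS orbT.
move=> x; split=> [Hx|[y [cy ->]]]; last exact: intH.
have /HA[y [cy Py]] : PH (P x) by exists x.
have cy0 n0 : coef (kind_at tau j (Some false)) (upd y j (IZR n0)).
  move=> c; rewrite /kind_at /upd; have [_|_] := eqVneq c j; first by exists n0.
  exact: cy.
have yj : upd y j 0 = y.
  apply: functional_extensionality => c; rewrite /upd; case: eqP => // ->.
  by have := cy j; rewrite tj.
(* After subtracting the lifted columns, [x] leaves a multiple of [v] lying in [H]. By [mult_v] it
   is an integer multiple, and this integer is the coefficient of column [j]. *)
set s := \rsum_(c : I) (kappa c * upd y j 0 c).
have zE : vminus x (mv (extend A v kappa) (upd y j 0)) = vscale (x j / v j - s) v.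
  rewrite mvE upd_upd yj -Py /s yj.
  by apply: functional_extensionality => i; rewrite /P /vminus /vplus /vscale; ring.
have [|n0 Hn0] := @mult_v (x j / v j - s).
  by rewrite -zE; apply: subgroup_minus => //; apply: intH; apply: (cy0 0%Z).
exists (upd y j (IZR n0)); split=> //.
rewrite mvE upd_upd yj (sum_upd kj) -/s -Hn0 -Py.
by apply: functional_extensionality => i; rewrite /P /vminus /vplus /vscale; ring.
Qed.

(* A cluster point [u] of the directions of arbitrarily short elements: integer multiples of
   these elements approximate every [t u]. *)
Lemma line_of_not_discrete H : subgroup H -> vclosed H -> ~ discrete H ->
  exists u, u <> (fun=> 0) /\ forall t, H (vscale t u).
Proof.
move=> sH cH nd.
pose dir x := vscale (/ nrm x) x.
pose P e x := [/\ H x, x <> (fun=> 0) & nrm x < e].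
have dir1 x j : x <> (fun=> 0) -> Rabs (dir x j) <= 1.
  move=> /nrm_gt0 n0; rewrite /dir /vscale Rabs_mult Rabs_inv (Rabs_pos_eq (nrm x)); last lra.
  have := Rmult_le_compat_l _ _ _ (Rlt_le _ _ (Rinv_0_lt_compat _ n0)) (nrm_coord x j).
  by rewrite Rinv_l; lra.
have [|||u Hu] := @cluster_point (I -> R) I 1 P dir.
- by move=> e e' x le [Hx nx lt]; split=> //; lra.
- move=> e e0; apply: NNPP => H1; apply: nd; exists e; split=> // x Hx lt.
  by apply: NNPP => nx; apply: H1; exists x.
- by move=> e x j [_ nx _]; apply: dir1.
exists u; split.
  move=> u0; have [|x [[Hx nx _] xu]] := Hu (/ 2); first lra.
  have n0 := nrm_gt0 nx; suff: nrm x <= / 2 * nrm x by lra.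
  apply: nrm_le => [|j]; first lra.
  have := xu j; rewrite u0 Rminus_0_r /dir /vscale Rabs_mult Rabs_inv (Rabs_pos_eq (nrm x)); last lra.
  move=> lt; have := Rmult_lt_compat_l _ _ _ n0 lt.
  by rewrite -Rmult_assoc Rinv_r; lra.
move=> t; apply: NNPP => /cH[e [e0 He]].
have t0 := Rabs_pos t.
(* Rounding t / nrm x costs at most half of [nrm x], below [d], and the error in the direction costs
   less than |t| d + d. *)
pose d := e / (Rabs t + 2); have d0 : 0 < d by apply: Rdiv_lt_0_compat; lra.
have [x [[Hx nx lt] xu]] := Hu d d0.
have n0 := nrm_gt0 nx; have [z tz] := nearest_int (t / nrm x).
apply: (He (vscale (IZR z) x)); last exact: subgroup_int.
move=> j; rewrite /vscale.
have -> : IZR z * x j - t * u j = - (t / nrm x - IZR z) * x j + t * (dir x j - u j).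
  by rewrite /dir /vscale; field; lra.
apply: Rle_lt_trans (Rabs_triang _ _) _; rewrite !Rabs_mult Rabs_Ropp.
have eE : e = (Rabs t + 2) * d by rewrite /d; field; lra.
have h1 := Rmult_le_compat _ _ _ _ (Rabs_pos _) (Rabs_pos _) tz (nrm_coord x j).
have h2 := Rmult_le_compat_l _ _ _ t0 (Rlt_le _ _ (xu j)).
lra.
Qed.

(** Induction on the number of supporting coordinates: a group that is not discrete contains a line,
    which is split off, and a discrete one is a lattice. *)
Lemma closed_subgroup_frame H : subgroup H -> vclosed H -> exists tau A C,
  [/\ normal_form tau A, 0 < C, bounded_below C tau A & forall x, H x <-> frame_group tau A x].
Proof.
move=> sH cH.
suff [tau [A [C [nf C0 bb _ HA]]]] : has_frame [set: I] H by exists tau, A, C.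
have HS : forall x i, H x -> i \notin [set: I] -> x i = 0 by move=> x i; rewrite inE.
have [n] := ubnP #|[set: I]|; move: HS; move: [set: I] => S.
elim: n => // n IHn in S H sH cH * => HS cS.
have [dH|/(line_of_not_discrete sH cH)[u [nu uH]]] := classic (discrete H).
  exact: frame_lattice.
have [j uj] := nonzero_coord nu.
have jS : j \in S.
  apply: contraT => /(HS _ _ (uH 1)); rewrite /vscale; lra.
apply: (@frame_line _ _ (vscale (/ u j) u) j) => //.
- move=> t; rewrite (_ : vscale _ _ = vscale (t * / u j) u) //.
  by apply: functional_extensionality => i; rewrite /vscale; ring.
- by rewrite /vscale Rinv_l.
move=> H' sH' cH' H'S; apply: IHn => //.
by move: cS; rewrite (cardsD1 j) jS.
Qed.
End Frames.

(** * Distances to rational points *)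

Definition rat (q : nat * nat * nat) : R := (INR q.1.1 - INR q.1.2) / INR q.2.+1.

Lemma rat_dense r e : 0 < e -> exists q, Rabs (r - rat q) < e.
Proof.
move=> e0; have [n [ne n0]] := archimed_cor1 e e0.
case: n ne n0 => [|n] ne n0; first lia.
have nR : 0 < INR n.+1 by apply: lt_0_INR; lia.
have [a [b ab]] := real_approx (INR n.+1 * r).
exists (a, b, n); rewrite /rat [(_, _, _).1]/= [(_, _, _).2]/=.
have -> : r - (INR a - INR b) / INR n.+1 = (INR n.+1 * r - (INR a - INR b)) * / INR n.+1.
  by field; lra.
rewrite Rabs_mult Rabs_inv (Rabs_pos_eq (INR n.+1)); last lra.
have i0 := Rinv_0_lt_compat _ nR.
have := Rmult_lt_compat_r _ _ _ i0 ab; lra.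
Qed.

Lemma rat_between a b : a < b -> exists q, a < rat q < b.
Proof.
move=> ab; have [|q /Rabs_def2 Hq] := @rat_dense ((a + b) / 2) ((b - a) / 2); first lra.
by exists q; lra.
Qed.

Definition irrational r := forall q, r <> rat q.

Lemma uniform_radius (K : countType) (P : K -> R -> Prop) n :
  (forall k d d', d' <= d -> P k d -> P k d') -> (forall k, exists d, 0 < d /\ P k d) ->
  exists d, 0 < d /\ forall k, (pickle k < n)%N -> P k d.
Proof.
move=> mono ex; elim: n => [|n [d [d0 Hd]]]; first by exists 1; split; first lra.
have [[k e]|H] := classic (exists k : K, pickle k = n).
  have [d' [d'0 Hd']] := ex k; exists (Rmin d d'); split; first exact: Rmin_glb_lt.
  move=> i; rewrite ltnS leq_eqVlt => /orP[/eqP ei|/Hd].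
    rewrite (_ : i = k); first exact: mono (Rmin_r _ _) Hd'.
    by apply: (pcan_inj pickleK); rewrite ei.
  exact: mono (Rmin_l _ _).
exists d; split=> // i; rewrite ltnS leq_eqVlt => /orP[/eqP ei|/Hd//].
by case: H; exists i.
Qed.

Section Charts.
Variable I : finType.
Implicit Types (x y : I -> R) (A : I * I -> R) (tau : I -> option bool) (F G : (I -> R) -> Prop).

Definition rat_index : countType := {ffun I -> nat * nat * nat}.
Definition rat_point (k : rat_index) : I -> R := fun i => rat (k i).

Lemma rat_point_dense x e : 0 < e -> exists k, nrm (vminus x (rat_point k)) < e.
Proof.
move=> e0; have [g Hg] := choice (fun i => rat_dense (x i) e0).
exists [ffun i => g i]; apply: nrm_lt => // i; rewrite /vminus /rat_point ffunE; exact: Hg.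
Qed.

(** Distances to countably many dense points: for closed subgroups they generate the Chabauty
    topology. For empty [F] the value is arbitrary, hence the witness [h0] below. *)
Definition rdist (k : rat_index) F : R :=
  inf (fun r => exists h, F h /\ r = nrm (vminus (rat_point k) h)).

Section NonEmpty.
Variables (F : (I -> R) -> Prop) (h0 : I -> R).
Hypothesis Fh0 : F h0.
Let ne k : exists r, exists h, F h /\ r = nrm (vminus (rat_point k) h).
Proof. by exists (nrm (vminus (rat_point k) h0)), h0. Qed.
Let ge0 k r : (exists h, F h /\ r = nrm (vminus (rat_point k) h)) -> 0 <= r.
Proof. by move=> [h [_ ->]]; apply: nrm_ge0. Qed.

Lemma rdist_le k h : F h -> rdist k F <= nrm (vminus (rat_point k) h).
Proof. by move=> Fh; apply: (inf_le (ne k) (@ge0 k)); exists h. Qed.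

Lemma rdist_ge k c : (forall h, F h -> c <= nrm (vminus (rat_point k) h)) -> c <= rdist k F.
Proof. by move=> H; apply: (le_inf (ne k) (@ge0 k)) => r [h [Fh ->]]; apply: H. Qed.

Lemma rdist_lt k c : rdist k F < c -> exists h, F h /\ nrm (vminus (rat_point k) h) < c.
Proof. by move/(inf_lt (ne k) (@ge0 k)) => [r [[h [Fh ->]] lt]]; exists h. Qed.

End NonEmpty.

Local Notation dist := (pdist rdist).

Lemma dist0_rdist F G k : dist F G <= 0 -> rdist k F = rdist k G.
Proof.
move=> d0; have := pdist_ge rdist F G k; have := weight_gt0 k => w0; rewrite /Rmin.
case: Rle_dec => _ H; first lra.
by apply: NNPP => ne; have := Rabs_pos_lt _ (Rminus_eq_contra _ _ ne); lra.
Qed.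

(** A point of [F] away from [G] would be detected by the distances to a rational point near it. *)
Lemma dist0_sub F G x0 : G x0 -> vclosed G -> dist F G <= 0 -> forall x, F x -> G x.
Proof.
move=> Gx0 cG d0 x Fx; apply: NNPP => /cG[e [e0 He]].
have [|k xk] := @rat_point_dense x (e / 2); first lra.
have lt : rdist k G < e / 2.
  rewrite -(dist0_rdist k d0); apply: Rle_lt_trans (rdist_le Fx k Fx) _.
  by rewrite nrm_minusC.
have [h [Gh hk]] := rdist_lt Gx0 lt; apply: (He h) => // j.
rewrite Rabs_minus_sym; apply: Rle_lt_trans (nrm_coord (vminus x h) j) _.
by have := nrm_minus_trans x (rat_point k) h; lra.
Qed.

(** Since 0 is in the group, nearly optimal elements have norm at most 2 |q| + 1, and the lower
    bound limits their coefficients by [C] times that. On such coefficients a change of the entries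
    by [e] moves the image by at most the error term. *)
Lemma rdist_frame_le C tau A A' k e : 0 < C -> bounded_below C tau A ->
  0 <= e -> (forall p, Rabs (A p - A' p) <= e) ->
  rdist k (frame_group tau A') <=
  rdist k (frame_group tau A) + e * (INR #|I| * (C * (2 * nrm (rat_point k) + 1))).
Proof.
move=> C0 bb e0 AA'; set q := rat_point k; set L := INR #|I| * _.
have n0 := pos_INR #|I|; have q0 := nrm_ge0 q.
have [z0 _ _] := frame_subgroup tau A; have [z0' _ _] := frame_subgroup tau A'.
set f := rdist k (frame_group tau A); set f' := rdist k (frame_group tau A').
have fq : f <= nrm q.
  have := rdist_le z0 k z0; rewrite (_ : vminus _ _ = q) //.
  by apply: functional_extensionality => i; rewrite /vminus Rminus_0_r.
apply: Rnot_lt_le => lt; set c := f + Rmin 1 (f' - (f + e * L)).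
have h1 := Rmin_l 1 (f' - (f + e * L)); have h2 := Rmin_r 1 (f' - (f + e * L)).
have h3 : 0 < Rmin 1 (f' - (f + e * L)) by apply: Rmin_glb_lt; lra.
have [|_ [[y [cy ->]] lty]] := @rdist_lt _ _ z0 k c; first by rewrite -/f /c; lra.
have y1 : nrm (mv A y) <= 2 * nrm q + 1.
  have v0 x : vminus x (fun=> 0) = x.
    by apply: functional_extensionality => i; rewrite /vminus Rminus_0_r.
  have := nrm_minus_trans (mv A y) q (fun=> 0).
  by rewrite !v0 (nrm_minusC (mv A y) q) => h4; rewrite -/q in lty; rewrite /c in lty *; lra.
have y2 := Rle_trans _ _ _ (bb y (coef_supported cy)) (Rmult_le_compat_l _ _ _ (Rlt_le _ _ C0) y1).
pose B p := A p - A' p.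
have d1 : vminus (rat_point k) (mv A' y) = vplus (vminus (rat_point k) (mv A y)) (mv B y).
  apply: functional_extensionality => i; rewrite /vplus /vminus.
  suff -> : mv A y i = mv A' y i + mv B y i by ring.
  by rewrite /mv -big_split; apply: eq_bigr => j _; rewrite /B /=; ring.
have d2 := nrm_mv_le y e0 AA'.
have d3 : nrm (mv B y) <= e * L.
  apply: Rle_trans d2 _; rewrite /L.
  have := Rmult_le_compat_l _ _ _ (Rmult_le_pos _ _ n0 e0) y2; lra.
have := rdist_le (F := frame_group tau A') z0' k (h := mv A' y) ltac:(by exists y).
rewrite -/f' d1; have := nrm_add (vminus (rat_point k) (mv A y)) (mv B y).
by rewrite /c in lty; lra.
Qed.

Lemma frame_dist_cont C tau A e : 0 < C -> 0 < e -> bounded_below C tau A ->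
  exists d, 0 < d /\ forall A', bounded_below C tau A' -> (forall p, Rabs (A p - A' p) < d) ->
    dist (frame_group tau A) (frame_group tau A') < e.
Proof.
move=> C0 e0 bb; have [|n Hn] := @pdist_small _ _ rdist (e / 2); first lra.
pose ok k d := forall A', bounded_below C tau A' -> (forall p, Rabs (A p - A' p) < d) ->
  Rabs (rdist k (frame_group tau A) - rdist k (frame_group tau A')) < e / 2.
have [||d [d0 Hd]] := @uniform_radius rat_index ok n.
- by move=> k d d' le Hd A' bb' AA'; apply: Hd => // p; have := AA' p; lra.
- move=> k; set L := INR #|I| * (C * (2 * nrm (rat_point k) + 1)).
  have q0 := nrm_ge0 (rat_point k).
  have L0 : 0 <= L by apply: Rmult_le_pos; [exact: pos_INR|apply: Rmult_le_pos; lra].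
  exists (e / (2 * (L + 1))); set d := e / _.
  have eE : e / 2 = d * L + d by rewrite /d; field; lra.
  have d0 : 0 < d by apply: Rdiv_lt_0_compat; lra.
  split=> // A' bb' AA'.
  have := @rdist_frame_le C tau A A' k d C0 bb (Rlt_le _ _ d0) (fun p => Rlt_le _ _ (AA' p)).
  have := @rdist_frame_le C tau A' A k d C0 bb' (Rlt_le _ _ d0).
  rewrite -/L => /(_ ltac:(by move=> p; rewrite Rabs_minus_sym; apply: Rlt_le)) h1 h2.
  by apply: Rabs_def1; lra.
exists d; split=> // A' bb' AA'; apply: Rle_lt_trans (_ : e / 2 < e); last lra.
by apply: Hn => k kn; apply: Hd.
Qed.

(** Taken up to distance 0, because a closed set of a pseudometric space contains with a point
    everything at distance 0 from it. *)
Definition shadow (Q : (I * I -> R) -> Prop) tau F := exists A, Q A /\ dist F (frame_group tau A) <= 0.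

(** Compactness of [Q]: matrices whose groups approach [F] cluster at a matrix of [Q], and by
    continuity its group is at distance 0 from [F]. *)
Lemma shadow_closed C tau (Q : (I * I -> R) -> Prop) r : 0 < C ->
  (forall A p, Q A -> Rabs (A p) <= r) -> vopen (fun A => ~ Q A) ->
  (forall A, Q A -> bounded_below C tau A) -> cls rdist (shadow Q tau).
Proof.
move=> C0 Qr Qcl Qbb F nF; apply: NNPP => H.
pose P e A := Q A /\ dist F (frame_group tau A) < e.
have [|||A HA] := @cluster_point (I * I -> R) _ r P (fun A => A).
- by move=> e e' A le [QA lt]; split=> //; lra.
- move=> e e0; apply: NNPP => nA; apply: H; exists e; split=> // G FG [A [QA GA]].
  by apply: nA; exists A; split=> //; have := pdist_triangle rdist F G (frame_group tau A); lra.
- by move=> e A p [/Qr].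
have QA : Q A.
  apply: NNPP => /Qcl[e [e0 He]]; have [A' [[QA' _] AA']] := HA e e0; exact: (He _ AA' QA').
apply: nF; exists A; split=> //; apply: Rnot_lt_le => lt.
set e1 := dist F (frame_group tau A) / 2.
have e10 : 0 < e1 by rewrite /e1; lra.
have [d [d0 Hd]] := frame_dist_cont C0 e10 (Qbb A QA).
have [A' [[QA' lt'] AA']] := HA (Rmin d e1) (Rmin_glb_lt _ _ _ d0 e10).
have h1 := Hd A' (Qbb _ QA')
  (fun p => ltac:(rewrite Rabs_minus_sym; exact: Rlt_le_trans (AA' p) (Rmin_l _ _))).
have h2 := Rmin_r d e1; have := pdist_triangle rdist F (frame_group tau A') (frame_group tau A).
by rewrite (pdistC _ (frame_group tau A') (frame_group tau A)) => h3; rewrite /e1 in h1 h2 lt' *; lra.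
Qed.

Lemma int_gap r : ~ isint r -> exists e, 0 < e /\ forall s, Rabs (s - r) < e -> ~ isint s.
Proof.
move=> nr; have [a b] := archimed r.
have b' : IZR (up r) - 1 < r.
  case: (Rle_lt_or_eq_dec _ _ b) => [|e]; first lra.
  by case: nr; exists (up r - 1)%Z; rewrite minus_IZR; lra.
exists (Rmin (IZR (up r) - r) (r - (IZR (up r) - 1))); split.
  by apply: Rmin_glb_lt; lra.
move=> s /Rabs_def2[h1 h2] [n sn]; have := Rmin_l (IZR (up r) - r) (r - (IZR (up r) - 1)).
have := Rmin_r (IZR (up r) - r) (r - (IZR (up r) - 1)) => h3 h4.
have : IZR n < IZR (up r) by lra.
have : IZR (up r - 1) < IZR n by rewrite minus_IZR; lra.
by move=> /lt_IZR ? /lt_IZR; lia.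
Qed.

Lemma coef_closed tau : vopen (fun y => ~ coef tau y).
Proof.
move=> y ny; have [c Hc] : exists c, ~ match tau c with
  Some true => True | Some false => isint (y c) | None => y c = 0 end.
  by apply: NNPP => H; apply: ny => c; apply: NNPP => nc; apply: H; exists c.
suff [e [e0 He]] : exists e, 0 < e /\ forall z : I -> R, Rabs (z c - y c) < e -> ~ match tau c with
  Some true => True | Some false => isint (z c) | None => z c = 0 end.
  by exists e; split=> // z /(_ c)/He nz /(_ c).
case: (tau c) Hc => [[]|] Hc; first by case: Hc.
  by have [e [e0 He]] := int_gap Hc; exists e; split=> // z; apply: He.
exists (Rabs (y c)); split; first exact: Rabs_pos_lt.
by move=> z lt z0; rewrite z0 Rminus_0_l Rabs_Ropp in lt; lra.
Qed.

(** The lower bound keeps the coefficients of approximating elements bounded, so they cluster at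
    admissible coefficients of the limit. *)
Lemma frame_closed C tau A : 0 < C -> bounded_below C tau A -> vclosed (frame_group tau A).
Proof.
move=> C0 bb x nx; apply: NNPP => H.
pose P e y := [/\ coef tau y, nrm (vminus (mv A y) x) < e & nrm y <= C * (nrm x + 1)].
have [|||y Hy] := @cluster_point (I -> R) I (C * (nrm x + 1)) P (fun y => y).
- by move=> e e' y le [cy lt b]; split=> //; lra.
- move=> e e0; apply: NNPP => ny; apply: H.
  have m0 : 0 < Rmin 1 e by apply: Rmin_glb_lt; lra.
  exists (Rmin 1 e); split=> // x' lt [y [cy x'E]]; have := nrm_lt m0 lt; rewrite x'E.
  rewrite -/(vminus (mv A y) x) => lt'.
  have h1 := Rmin_l 1 e; have h2 := Rmin_r 1 e.
  apply: ny; exists y; split=> //; first lra.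
  apply: Rle_trans (bb y (coef_supported cy)) _; apply: Rmult_le_compat_l; first lra.
  have := nrm_add (vminus (mv A y) x) x; rewrite (_ : vplus _ _ = mv A y); first lra.
  by apply: functional_extensionality => i; rewrite /vplus /vminus; ring.
- by move=> e y j [_ _]; apply: Rle_trans (nrm_coord _ _).
have cy : coef tau y.
  apply: NNPP => /coef_closed[e [e0 He]]; have [y' [[cy' _ _] yy']] := Hy e e0; exact: (He _ yy' cy').
apply: nx; exists y; split=> //.
suff /nrm_zero_eq/(fun e => congr1 (fun f => f _) e) e0 : nrm (vminus (mv A y) x) <= 0.
  by apply: functional_extensionality => i; have := e0 i; rewrite /vminus; lra.
apply: Rnot_lt_le => lt; set e := nrm (vminus (mv A y) x) in lt.
set M := INR #|I| * nrm (fun p => A p); have M0 : 0 <= M.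
  by apply: Rmult_le_pos; [exact: pos_INR|exact: nrm_ge0].
set d := e / (M + 2); have d0 : 0 < d by apply: Rdiv_lt_0_compat; lra.
have [y' [[cy' lt' _] yy']] := Hy d d0.
have ny : nrm (vminus y y') <= d.
  by apply: nrm_le => [|j]; [lra|rewrite /vminus Rabs_minus_sym; apply: Rlt_le].
have h1 := nrm_mv_le (A := A) (vminus y y') (nrm_ge0 (fun p => A p)) (nrm_coord (fun p => A p)).
have h2 := Rmult_le_compat_l _ _ _ M0 ny.
have := nrm_minus_trans (mv A y) (mv A y') x; rewrite -mv_minus -/e => h3.
have : e = M * d + 2 * d by rewrite /d; field; lra.
by rewrite -/M in h1; lra.
Qed.
End Charts.

(** * Charts of the space of closed subgroups *)

Section Closed.
Variable J : finType.
Implicit Types (P Q : (J -> R) -> Prop).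

Lemma vclosed_all (T : Type) (P : T -> (J -> R) -> Prop) :
  (forall t, vclosed (P t)) -> vclosed (fun x => forall t, P t x).
Proof.
move=> cP x nx; have [t nt] : exists t, ~ P t x.
  by apply: NNPP => H; apply: nx => t; apply: NNPP => nt; apply: H; exists t.
by have [e [e0 He]] := cP t x nt; exists e; split=> // y /He nP /(_ t).
Qed.

Lemma vclosed_imp (h : Prop) P : vclosed P -> vclosed (fun x => h -> P x).
Proof. by move=> cP; apply: vclosed_all. Qed.

Lemma vclosed_and P Q : vclosed P -> vclosed Q -> vclosed (fun x => P x /\ Q x).
Proof.
move=> cP cQ x /not_and_or[/cP|/cQ][e [e0 He]]; exists e; split=> // y /He; tauto.
Qed.

Lemma vclosed_or P Q : vclosed P -> vclosed Q -> vclosed (fun x => P x \/ Q x).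
Proof.
move=> cP cQ x /not_or_and[/cP[e [e0 He]] /cQ[e' [e'0 He']]].
exists (Rmin e e'); split=> [|y lt]; first exact: Rmin_glb_lt.
have h1 := Rmin_l e e'; have h2 := Rmin_r e e'.
have := He y (fun j => ltac:(have := lt j; lra)).
have := He' y (fun j => ltac:(have := lt j; lra)); tauto.
Qed.

Lemma vclosed_ex_mem (T : eqType) (L : seq T) (P : T -> (J -> R) -> Prop) :
  (forall t, vclosed (P t)) -> vclosed (fun x => exists t, t \in L /\ P t x).
Proof.
move=> cP; elim: L => [|t L IH].
  by move=> x _; exists 1; split=> [|y _ [t [//]]]; lra.
move=> x nx; have [|e [e0 He]] := vclosed_or (cP t) IH (x := x).
  case=> [Pt|[s [sL Ps]]]; apply: nx; first by exists t; rewrite mem_head.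
  by exists s; rewrite inE sL orbT.
exists e; split=> // y /He ny [s []]; rewrite inE => /orP[/eqP-> Pt|sL Ps]; apply: ny.
  by left.
by right; exists s.
Qed.

Lemma vclosed_le p a : vclosed (fun x : J -> R => x p <= a).
Proof.
move=> x /Rnot_le_lt lt; exists (x p - a); split=> [|y /(_ p)/Rabs_def2]; lra.
Qed.

Lemma vclosed_ge p a : vclosed (fun x : J -> R => a <= x p).
Proof.
move=> x /Rnot_le_lt lt; exists (a - x p); split=> [|y /(_ p)/Rabs_def2]; lra.
Qed.

Lemma vclosed_iff P Q : (forall x, P x <-> Q x) -> vclosed P -> vclosed Q.
Proof.
move=> PQ cP x nQ; have [|e [e0 He]] := cP x; first by move/PQ.
by exists e; split=> // y /He nP /PQ.
Qed.

Lemma vclosed_eq p a : vclosed (fun x : J -> R => x p = a).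
Proof.
apply: vclosed_iff (vclosed_and (vclosed_le (p := p) (a := a)) (vclosed_ge (p := p) (a := a))) => x; lra.
Qed.

Lemma vclosed_dist p a b : vclosed (fun x : J -> R => Rabs (x p - a) <= b).
Proof.
apply: vclosed_iff (vclosed_and (vclosed_le (p := p) (a := a + b)) (vclosed_ge (p := p) (a := a - b))) => x.
split=> [H|]; first by apply: Rabs_le; lra.
have := Rle_abs (x p - a); have := Rle_abs (- (x p - a)); rewrite Rabs_Ropp; lra.
Qed.
End Closed.

(** * Charts and their zero-dimensional strata *)

Section Strata.
Variable I : finType.
Local Notation dist := (pdist (@rdist I)).
Implicit Types (A B : I * I -> R) (F G H : (I -> R) -> Prop).

Section Chart.
Variables (tau : I -> option bool) (A0 : I * I -> R) (C : R).
Hypothesis C0 : 0 < C.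

(* The radius makes [frame_group tau] injective on the chart. *)
Definition chart A := [/\ normal_form tau A, bounded_below C tau A &
  forall p, Rabs (A p - A0 p) <= / (8 * C)].

Lemma bounded_below_closed : vclosed (bounded_below C tau).
Proof.
apply: vclosed_all => y; apply: vclosed_imp => A /Rnot_le_lt lt.
set N := nrm y in lt *; have N0 : 0 <= N := nrm_ge0 y.
set n := INR #|I|; have n0 : 0 <= n := pos_INR _.
set M := C * n * N; have M0 : 0 <= M by apply: Rmult_le_pos => //; apply: Rmult_le_pos; lra.
set e := (N - C * nrm (mv A y)) / (M + 1).
have e0 : 0 < e by apply: Rdiv_lt_0_compat; lra.
exists e; split=> // B BA; apply: Rlt_not_le.
pose E p := B p - A p.
have h1 := @nrm_mv_le _ E y e (Rlt_le _ _ e0) (fun p => Rlt_le _ _ (BA p)).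
have h2 : mv B y = vplus (mv A y) (mv E y).
  apply: functional_extensionality => i; rewrite /vplus /mv -big_split.
  by apply: eq_bigr => j _; rewrite /E /=; ring.
have h3 := nrm_add (mv A y) (mv E y); rewrite -h2 in h3.
have h4 : N - C * nrm (mv A y) = M * e + e by rewrite /e; field; lra.
have := Rmult_le_compat_l _ _ _ (Rlt_le _ _ C0)
  (Rle_trans _ _ _ h3 (Rplus_le_compat_l (nrm (mv A y)) _ _ h1)).
by rewrite -/N -/n /M in h4 *; lra.
Qed.

Lemma chart_closed : vclosed chart.
Proof.
have H : vclosed (fun A => (normal_form tau A /\ bounded_below C tau A) /\
    forall p, Rabs (A p - A0 p) <= / (8 * C)).
  apply: vclosed_and; first apply: vclosed_and.
  - apply: vclosed_and; apply: vclosed_all => i; apply: vclosed_all => c; apply: vclosed_imp;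
    exact: vclosed_eq.
  - exact: bounded_below_closed.
  - by apply: vclosed_all => p; apply: vclosed_dist.
by apply: vclosed_iff H => A; split=> [[[]]|[]].
Qed.

Lemma chart_shadow_closed (P : (I * I -> R) -> Prop) : vclosed P ->
  cls (@rdist I) (shadow (fun A => chart A /\ P A) tau).
Proof.
move=> cP; apply: (@shadow_closed I C tau _ (nrm A0 + / (8 * C)) C0).
- move=> A p [[_ _ /(_ p) h] _]; have := nrm_coord A0 p.
  by have := Rabs_triang (A p - A0 p) (A0 p); rewrite (_ : _ + A0 p = A p); [lra|ring].
- exact: vclosed_and chart_closed cP.
- by move=> A [[]].
Qed.

(** A used column [c] of [A] is [mv B y] for admissible [y]. With [z] the difference of [y] and the
    unit vector, [mv B z] is the difference of the two columns, at most 2/(8C), so [z] is at most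
    1/4. Its integer entries vanish for that reason, its line entries because both matrices have the
    same unit rows. *)
Lemma chart_inj A B : chart A -> chart B -> dist (frame_group tau A) (frame_group tau B) <= 0 -> A = B.
Proof.
move=> [nfA bbA nearA] [nfB bbB nearB] d0.
have [z0 _ _] := frame_subgroup tau B.
have sub := dist0_sub z0 (frame_closed C0 bbB) d0.
have C8 : C * / (8 * C) = / 8 by field; lra.
have i8 : 0 < / (8 * C) by apply: Rinv_0_lt_compat; lra.
apply: functional_extensionality => -[i c].
have [tc|tc] := classic (tau c = None); first by rewrite (proj2 nfA) // (proj2 nfB).
have [y [cy yE]] := sub _ (frame_column A tc).
have cu := coef_unit tc; set z := vminus y (unitv c).
have cz : coef tau z by exact: (subgroup_minus (coef_subgroup tau) cy cu).
have zE k : mv B z k = A (k, c) - B (k, c).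
  by rewrite mv_minus /vminus mv_unit -(congr1 (fun f => f k) yE).
have nz : nrm z <= / 4.
  have h : nrm (mv B z) <= 2 * / (8 * C).
    apply: nrm_le => [|k]; first lra.
    rewrite zE; have := nearA (k, c); have := nearB (k, c); rewrite (Rabs_minus_sym (B _)) => h1 h2.
    have := Rabs_triang (A (k, c) - A0 (k, c)) (A0 (k, c) - B (k, c)).
    by rewrite (_ : _ + (A0 (k, c) - B (k, c)) = A (k, c) - B (k, c)); [lra|ring].
  have := Rmult_le_compat_l _ _ _ (Rlt_le _ _ C0) h; have := bbB z (coef_supported cz); lra.
have z00 k : z k = 0.
  have := cz k; case ek : (tau k) => [[]|] //.
    move=> _; have := zE k; rewrite (proj1 nfA _ _ ek) (proj1 nfB _ _ ek) /mv (bigD1 k) //=.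
    rewrite big1 => [|l lk]; first by rewrite (proj1 nfB _ _ ek) /unitv eqxx; lra.
    by rewrite (proj1 nfB _ _ ek) /unitv (negbTE lk); ring.
  by move=> iz; apply: isint_small => //; have := nrm_coord z k; lra.
have := zE i; rewrite (_ : z = fun=> 0); last exact: functional_extensionality.
by rewrite mv0; lra.
Qed.

Lemma chart_unique F A B : chart A -> chart B ->
  dist F (frame_group tau A) <= 0 -> dist F (frame_group tau B) <= 0 -> A = B.
Proof.
move=> cA cB dA dB; apply: chart_inj => //.
by have := pdist_triangle (@rdist I) (frame_group tau A) F (frame_group tau B); rewrite (pdistC _ _ F); lra.
Qed.

Definition irr_entries A : {set I * I} := [set p | truth (irrational (A p))].

Lemma irr_entriesP A p : reflect (irrational (A p)) (p \in irr_entries A).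
Proof. by rewrite inE /truth; case: excluded_middle_informative => H; constructor. Qed.

(* Boxes with rational bounds have no boundary points among matrices whose free entries are
   all irrational. *)
Lemma zd_piece (T : {set I * I}) (r : I * I -> nat * nat * nat) :
  zd (@rdist I) (shadow (fun A => [/\ chart A, irr_entries A = T &
    forall p, p \notin T -> A p = rat (r p)]) tau).
Proof.
move=> F e [A [[cA iA rA] dA]] e0.
have [_ bbA _] := cA.
have [d [d0 Hd]] := frame_dist_cont C0 e0 bbA.
have [lo Hlo] := choice (fun p => @rat_between (A p - d) (A p) ltac:(lra)).
have [hi Hhi] := choice (fun p => @rat_between (A p) (A p + d) ltac:(lra)).
pose V := shadow (fun B => chart B /\ ((forall p, p \notin T -> B p = rat (r p)) /\
  forall p, rat (lo p) <= B p /\ B p <= rat (hi p) \/ p \notin T)) tau.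
pose W := shadow (fun B => chart B /\ exists p, p \in enum T /\ (B p <= rat (lo p) \/ rat (hi p) <= B p)) tau.
exists V, W; split.
- apply: chart_shadow_closed; apply: vclosed_and; apply: vclosed_all => p.
    by apply: vclosed_imp; apply: vclosed_eq.
  apply: vclosed_or; last by move=> B nB; exists 1; split=> //; lra.
  by apply: vclosed_and; [apply: vclosed_ge|apply: vclosed_le].
- apply: chart_shadow_closed; apply: vclosed_ex_mem => p.
  by apply: vclosed_or; [apply: vclosed_le|apply: vclosed_ge].
- move=> G [B [[cB iB rB] dB]].
  have [H|H] := classic (forall p, p \in T -> rat (lo p) <= B p <= rat (hi p)).
    left; exists B; split=> //; split=> //; split=> // p.
    by case pT : (p \in T); [left; apply: H|right].
  right; exists B; split=> //; split=> //; apply: NNPP => nW; apply: H => p pT.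
  by split; apply: Rnot_lt_le => lt; apply: nW; exists p; rewrite mem_enum pT; split=> //; lra.
- move=> G [B [[cB iB rB] dB]] [B1 [[cB1 [_ bd]] dB1]] [B2 [[cB2 [p [pT out]]] dB2]].
  rewrite mem_enum in pT.
  have e1 := chart_unique cB cB1 dB dB1; have e2 := chart_unique cB cB2 dB dB2; subst B1 B2.
  have /irr_entriesP ip : p \in irr_entries B by rewrite iB.
  case: (bd p) => [[b1 b2]|]; last by rewrite pT.
  case: out => out; [apply: (ip (lo p))|apply: (ip (hi p))]; lra.
split.
  exists A; split=> //; split=> //; split=> // p; left.
  by have := Hlo p; have := Hhi p; lra.
move=> G _ [B [[cB [rB bd]] dB]].
have [_ bbB _] := cB.
have := Hd B bbB; have := pdist_triangle (@rdist I) F (frame_group tau A) G.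
have := pdist_triangle (@rdist I) (frame_group tau A) (frame_group tau B) G.
rewrite (pdistC _ (frame_group tau B) G) => h1 h2 h3.
suff : forall p, Rabs (A p - B p) < d by move/h3; lra.
move=> p; case pT : (p \in T).
  case: (bd p) => [b|]; last by rewrite pT.
  by have h4 := Hlo p; have h5 := Hhi p; apply: Rabs_def1; lra.
by rewrite rA ?rB ?pT // Rminus_diag Rabs_R0.
Qed.

(** Level [n] has exactly [n] irrational entries. Prescribing rational values outside a set [T] is a
    closed condition; within level [n], when [T] has [n] elements, it forces all entries in [T] to
    be irrational, so countably many [zd_piece] sets make up the level. *)
Lemma zd_cover_chart : zd_cover (@rdist I) #|{: I * I}|.+1 (shadow chart tau).
Proof.
exists (fun n => shadow (fun A => chart A /\ #|irr_entries A| = n) tau); split; last first.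
  move=> F [A [cA dA]]; exists #|irr_entries A|; split; first by rewrite ltnS max_card.
  by exists A.
move=> n _.
apply: (@zd_sum _ _ _ (({set I * I} * {ffun I * I -> nat * nat * nat})%type : countType)
  (fun Tr => shadow (fun A => chart A /\
    (#|Tr.1| = n /\ forall p, p \notin Tr.1 -> A p = rat (Tr.2 p))) tau)).
- move=> [T r] /=; apply: chart_shadow_closed; apply: vclosed_and.
    by move=> A nA; exists 1; split=> //; lra.
  by apply: vclosed_all => p; apply: vclosed_imp; apply: vclosed_eq.
- move=> F [A [[cA nA] dA]].
  have ex p : exists q, p \notin irr_entries A -> A p = rat q.
    have [|H] := boolP (p \in irr_entries A); first by exists (0, 0, 0)%N.
    apply: NNPP => nq; move/irr_entriesP: H; apply=> q Aq; apply: nq; by exists q.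
  have [r Hr] := choice ex; exists (irr_entries A, [ffun p => r p]), A; split=> //.
  by split=> //; split=> // p /=; rewrite ffunE; apply: Hr.
move=> [T r]; apply: (zd_sub _ (@zd_piece T r)) => F [[A [[cA nA] dA]] [B [[cB [nT rB]] dB]]].
have e := chart_unique cA cB dA dB; subst B; exists A; split=> //; split=> //.
apply/eqP; rewrite eqEcard nA nT leqnn andbT; apply/subsetP => p /irr_entriesP ip.
by apply: contraT => /rB /= Ap; case: (ip (r p)).
Qed.
End Chart.

Definition closed_subgroups H := subgroup H /\ vclosed H.

Lemma zd_cover_closed_subgroups : zd_cover (@rdist I) #|{: I * I}|.+1 closed_subgroups.
Proof.
pose index : countType := ({ffun I -> option bool} * {ffun I * I -> nat * nat * nat} * nat)%type.
pose piece (m : index) := shadow (chart m.1.1 (fun p => rat (m.1.2 p)) (INR m.2.+1)) m.1.1.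
have pos n : 0 < INR n.+1 by apply: lt_0_INR; lia.
apply: (@zd_cover_sum _ _ _ index piece).
- move=> [[tau a0] n].
  have := @chart_shadow_closed tau (fun p => rat (a0 p)) (INR n.+1) (pos n) (fun=> True).
  have -> : (fun A => chart tau (fun p => rat (a0 p)) (INR n.+1) A /\ True) =
      chart tau (fun p => rat (a0 p)) (INR n.+1).
    apply: functional_extensionality => A; apply: propositional_extensionality; tauto.
  by apply=> A; case.
- move=> H [sH cH]; have [tau [A [C [nf C0 bb HA]]]] := closed_subgroup_frame sH cH.
  have [n Cn] := INR_unbounded C.
  have Cn' : C <= INR n.+1 by rewrite S_INR; lra.
  have i0 : 0 < / (8 * INR n.+1) by apply: Rinv_0_lt_compat; have := pos n; lra.
  have [a0 Ha0] := choice (fun p => rat_dense (A p) i0).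
  exists ([ffun i => tau i], [ffun p => a0 p], n), A => /=.
  have -> : fun_of_fin [ffun i => tau i] = tau.
    by apply: functional_extensionality => i; rewrite ffunE.
  have -> : H = frame_group tau A.
    by apply: functional_extensionality => x; apply: propositional_extensionality.
  split; last by rewrite pdistxx; lra.
  split=> //.
    move=> y /bb h; apply: Rle_trans h _; apply: Rmult_le_compat_r => //; exact: nrm_ge0.
  by move=> p; rewrite ffunE; apply: Rlt_le.
move=> [[tau a0] n]; apply: zd_cover_sub (zd_cover_chart tau (fun p => rat (a0 p)) (pos n)) => H [_].
exact.
Qed.

Lemma closed_subgroups_no_zd_cover : ~ zd_cover (@rdist I) #|{: I * I}| closed_subgroups.
Proof.
move=> [Zs [zZ cov]].
pose tau : I -> option bool := fun=> Some false.
pose C := 2; have C0 : 0 < C by rewrite /C; lra.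
set n := INR #|I|; have n0 : 0 <= n := pos_INR _.
(* Perturbing the identity by [d] per entry changes images by at most n d |y|, less than |y|/2,
   which gives the lower bound with [C] = 2; moreover d <= 1/16 = 1/(8C), so the cube lies in one
   chart. *)
pose d := / (16 * (n + 1)).
have d0 : 0 < d by apply: Rinv_0_lt_compat; lra.
have nd : n * d + d = / 16 by rewrite /d; field; lra.
have nd0 : 0 <= n * d by apply: Rmult_le_pos; lra.
pose A0 : I * I -> R := fun p => unitv p.1 p.2.
have A0_id y : mv A0 y = y.
  apply: functional_extensionality => i; rewrite /mv (bigD1 i) //= big1 => [|c ci].
    by rewrite /A0 /unitv /= eqxx; lra.
  by rewrite /A0 /unitv /= (negbTE ci) Rmult_0_l.
pose M (x : I * I -> R) : I * I -> R := fun p => A0 p + (2 * x p - 1) * d.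
have Mbd x : in_cube x -> forall p, Rabs (M x p - A0 p) <= d.
  move=> cx p; rewrite /M (_ : _ - _ = (2 * x p - 1) * d); last by ring.
  by have := cx p; move=> ?; apply: Rabs_le; nra.
have Mchart x : in_cube x -> chart tau A0 C (M x).
  move=> cx; split=> //.
    move=> y _; pose E p := M x p - A0 p.
    have h1 := @nrm_mv_le _ E y d (Rlt_le _ _ d0) (Mbd x cx).
    have h2 : y = vminus (mv (M x) y) (mv E y).
      rewrite -{1}(A0_id y); apply: functional_extensionality => i; rewrite /vminus.
      suff -> : mv (M x) y i = mv A0 y i + mv E y i by ring.
      by rewrite /mv -big_split; apply: eq_bigr => j _; rewrite /E /=; ring.
    have h3 : nrm y <= nrm (mv (M x) y) + nrm (mv E y).
      rewrite {1}h2 vminusE; apply: Rle_trans (nrm_add _ _) _.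
      have := nrm_scale_le (-1) (mv E y); rewrite Rabs_Ropp Rabs_R1; lra.
    have := nrm_ge0 y; rewrite -/n in h1; rewrite /C => y0; nra.
  by move=> p; have := Mbd x cx p; rewrite /C (_ : / (8 * 2) = / 16); [lra|field].
have Mgroup x : in_cube x -> closed_subgroups (frame_group tau (M x)).
  move=> /Mchart[_ bb _]; split; [exact: frame_subgroup|exact: frame_closed bb].
have Mcont x e : in_cube x -> 0 < e -> exists r, 0 < r /\ forall y, in_cube y ->
    (forall p, Rabs (y p - x p) < r) -> dist (frame_group tau (M x)) (frame_group tau (M y)) < e.
  move=> /Mchart[_ bb _] e0; have [r [r0 Hr]] := frame_dist_cont C0 e0 bb.
  exists r; split=> // y /Mchart[_ bb' _] xy; apply: Hr => // p.
  rewrite (_ : M x p - M y p = (2 * d) * - (y p - x p)); last by rewrite /M; ring.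
  rewrite Rabs_mult Rabs_Ropp (Rabs_pos_eq (2 * d)); last lra.
  by have := xy p; have := Rabs_pos (y p - x p); nra.
(* The face is taken in the whole chart, which makes it closed; injectivity of the chart keeps
   opposite faces disjoint. *)
pose face p s := shadow (fun A => chart tau A0 C A /\ A p = A0 p + s * d) tau.
have face_closed p s : cls (@rdist I) (face p s).
  by apply: chart_shadow_closed => //; apply: vclosed_eq.
have [U HU] : exists U : I * I -> (((I -> R) -> Prop) -> Prop) * (((I -> R) -> Prop) -> Prop), forall p,
    [/\ opn (@rdist I) (U p).1, opn (@rdist I) (U p).2, forall F, (U p).1 F -> ~ (U p).2 F,
     forall F, Zs (enum_rank p) F -> (U p).1 F \/ (U p).2 F &
     (forall F, face p (-1) F -> (U p).1 F) /\ (forall F, face p 1 F -> (U p).2 F)].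
  apply: (choice (P := fun p U => [/\ opn (@rdist I) U.1, opn (@rdist I) U.2, forall F, U.1 F -> ~ U.2 F,
     forall F, Zs (enum_rank p) F -> U.1 F \/ U.2 F &
     (forall F, face p (-1) F -> U.1 F) /\ (forall F, face p 1 F -> U.2 F)])) => p.
  have [||F||U [V H]] := @separate_off_zd _ _ (@rdist I) (face p (-1)) (face p 1) (Zs (enum_rank p)) => //.
  - move=> [A [[cA a1] dA]] [B [[cB b1] dB]]; have e := chart_unique C0 cA cB dA dB; subst B; lra.
  - exact: zZ.
  by exists (U, V).
have [||x [cx Hx]] := @poincare_miranda _ (fun p x => ~ (U p).1 (frame_group tau (M x))).
- move=> p x cx x0; apply; have [_ _ _ _ [H _]] := HU p; apply: H; exists (M x); split.
    by split; [apply: Mchart|rewrite /M x0; ring].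
  by rewrite pdistxx; lra.
- move=> p x cx x1; have [_ _ H1 _ [_ H2]] := HU p => H3; apply: (H1 _ H3).
  apply: H2; exists (M x); split; last by rewrite pdistxx; lra.
  by split; [apply: Mchart|rewrite /M x1; ring].
(* The group at the common point lies in some [Zs i], hence in one of the two open sets of the
   matching partition. By continuity nearby groups stay in it, against the points of both kinds
   found arbitrarily near. *)
have [i [ltn Zi]] := cov _ (Mgroup x cx).
pose p := enum_val (Ordinal ltn).
have [oU oV dUV covp _] := HU p.
have : Zs (enum_rank p) (frame_group tau (M x)) by rewrite /p enum_valK.
case/covp => [Ux|Vx].
  have [e [e0 He]] := oU _ Ux; have [r [r0 Hr]] := Mcont x e cx e0.
  have [y [z [[cy cz] yx zx ny nz]]] := Hx p r r0.
  by apply: nz; apply: He; apply: Hr.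
have [e [e0 He]] := oV _ Vx; have [r [r0 Hr]] := Mcont x e cx e0.
have [y [z [[cy cz] yx zx ny nz]]] := Hx p r r0.
by apply: ny => Uy; apply: (dUV _ Uy); apply: He; apply: Hr.
Qed.
End Strata.

(** * The Chabauty topology *)

Section FinT.
Variable d : nat.

Definition fin_to_ord (i : Fin.t d) : 'I_d :=
  Ordinal (introT ltP (proj2_sig (Fin.to_nat i))).

Definition ord_to_fin (i : 'I_d) : Fin.t d := Fin.of_nat_lt (elimT ltP (ltn_ord i)).

Lemma fin_to_ordK : cancel fin_to_ord ord_to_fin.
Proof.
move=> i; rewrite -[RHS]Fin.of_nat_to_nat_inv /ord_to_fin.
exact: Fin.of_nat_ext.
Qed.

Lemma ord_to_finK : cancel ord_to_fin fin_to_ord.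
Proof. by move=> i; apply: val_inj; rewrite /= /ord_to_fin Fin.to_nat_of_nat. Qed.
End FinT.

HB.instance Definition _ (d : nat) := Finite.copy (Fin.t d) (can_type (@fin_to_ordK d)).

Lemma card_fin d : #|{: Fin.t d}| = d.
Proof.
by rewrite -[RHS]card_ord; apply: bij_eq_card; exists (@ord_to_fin d);
  [exact: fin_to_ordK|exact: ord_to_finK].
Qed.

Section Chabauty.
Variable d : nat.
Local Notation dist := (pdist (@rdist (Fin.t d))).
Implicit Types (F G : Vec d -> Prop).

Lemma closed_subgroupE : @closed_subgroup d = closed_subgroups (I := Fin.t d).
Proof.
apply: functional_extensionality => H; apply: propositional_extensionality.
by split=> [[h0 [hp [hn hc]]]|[[h0 hp hn] hc]].
Qed.

Lemma compact_ball (x : Vec d) r : compactR (fun y => nrm (vminus (x : Fin.t d -> R) y) <= r).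
Proof.
move=> I G Gop Gcov; apply: (@bounded_closed_cover _ (nrm (x : Fin.t d -> R) + r)) Gcov => //.
- move=> y j; have := nrm_minus_trans (y : Fin.t d -> R) x (fun=> 0).
  have v0 z : vminus (z : Fin.t d -> R) (fun=> 0) = z.
    by apply: functional_extensionality => i; rewrite /vminus Rminus_0_r.
  rewrite !v0 (nrm_minusC y) => h1 h2; have := nrm_coord (y : Fin.t d -> R) j; lra.
- move=> y /Rnot_le_lt lt; pose e := nrm (vminus (x : Fin.t d -> R) y) - r.
  have e0 : 0 < e by rewrite /e; lra.
  exists e; split=> // z yz; have := nrm_lt (x := vminus z y) e0 yz.
  have := nrm_minus_trans (x : Fin.t d -> R) z y; rewrite /e; lra.
Qed.

Lemma open_ball (x : Vec d) r : openR (fun y => nrm (vminus (x : Fin.t d -> R) y) < r).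
Proof.
move=> y lt; pose e := r - nrm (vminus (x : Fin.t d -> R) y).
have e0 : 0 < e by rewrite /e; lra.
exists e; split=> // z yz; have := nrm_lt (x := vminus z y) e0 yz.
by have := nrm_minus_trans (x : Fin.t d -> R) y z; rewrite (nrm_minusC z) /e; lra.
Qed.

(** An upper bound on the distance from a point says that an open ball is hit, a lower bound that a
    compact ball is missed. *)
Lemma chabauty_rdist_nbhd F k e : closed_subgroup F -> 0 < e -> exists l,
  [/\ Forall (@chabauty_subbasis d) l, forall S, In S l -> S F &
   forall G, closed_subgroup G -> (forall S, In S l -> S G) ->
     Rabs (rdist (I := Fin.t d) k F - rdist (I := Fin.t d) k G) < e].
Proof.
move=> [F0 _] e0; set f := rdist k F; set q : Vec d := rat_point k.
pose S1 (G : Vec d -> Prop) := exists x, G x /\ nrm (vminus (q : Fin.t d -> R) x) < f + e / 2.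
pose S2 (G : Vec d -> Prop) := forall x, ~ (G x /\ nrm (vminus (q : Fin.t d -> R) x) <= f - e / 2).
exists [:: S1; S2]; split.
- apply: Forall_cons; last apply: Forall_cons; last exact: Forall_nil.
    by right; eexists; split; first exact: (@open_ball q (f + e / 2)).
  by left; eexists; split; first exact: (@compact_ball q (f - e / 2)).
- move=> S /= [<-|[<-|//]].
    by have [|x [Fx lt]] := rdist_lt F0 (k := k) (c := f + e / 2); [rewrite -/f; lra|exists x].
  move=> x [Fx le]; have h : f <= nrm (vminus (q : Fin.t d -> R) x) := rdist_le F0 k Fx. lra.
move=> G [G0 _] HG.
have [x [Gx lt]] : S1 G by apply: HG; left.
have s2 : S2 G by apply: HG; right; left.
have h1 : rdist (I := Fin.t d) k G <= nrm (vminus (q : Fin.t d -> R) x) := rdist_le G0 k Gx.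
have h2 : f - e / 2 <= rdist (I := Fin.t d) k G.
  by apply: (rdist_ge G0) => y Gy; apply: Rnot_lt_le => yl; apply: (s2 y); split=> //; apply: Rlt_le.
by apply: Rabs_def1; lra.
Qed.

Lemma chabauty_finer O : opn (@rdist (Fin.t d)) O -> openIn _ (@chabauty_open d) closed_subgroup O.
Proof.
move=> oO.
(* Chabauty-open sets consist of arbitrary subsets of R^d, so [O] is replaced by the union of the
   basic sets whose closed subgroups belong to [O]. *)
exists (fun F => exists l, [/\ Forall (@chabauty_subbasis d) l, forall S, In S l -> S F &
  forall G, closed_subgroup G -> (forall S, In S l -> S G) -> O G]); split.
  by move=> F [l [bl lF lO]]; exists l; split=> //; split=> // G lG; exists l.
move=> F cF; split=> [OF|[l [_ lF]]]; last exact.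
have [e [e0 He]] := oO F OF.
have [|n Hn] := @pdist_small _ _ (@rdist (Fin.t d)) (e / 2); first lra.
pose ok m l := [/\ Forall (@chabauty_subbasis d) l, forall S, In S l -> S F &
   forall G, closed_subgroup G -> (forall S, In S l -> S G) ->
   forall k, (pickle k < m)%N -> Rabs (rdist (I := Fin.t d) k F - rdist (I := Fin.t d) k G) < e / 2].
have [l [bl lF lO]] : exists l, ok n l.
  elim: (n) => [|m [l [bl lF lO]]]; first by exists nil; split.
  have [[k ek]|nk] := classic (exists k : rat_index (Fin.t d), pickle k = m); last first.
    exists l; split=> // G cG lG k; rewrite ltnS leq_eqVlt => /orP[/eqP ek|]; last exact: lO.
    by case: nk; exists k.
  have [|l' [bl' lF' lO']] := @chabauty_rdist_nbhd F k (e / 2) cF; first lra.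
  exists (l ++ l')%list; split.
  - exact/Forall_app.
  - by move=> S Sl; have [h|h] := in_app_or _ _ _ Sl; [apply: lF|apply: lF'].
  - move=> G cG lG i; rewrite ltnS leq_eqVlt => /orP[/eqP ei|].
      rewrite (_ : i = k); last by apply: (pcan_inj pickleK); rewrite ei.
      by apply: lO' => // S Sl; apply: lG; apply: in_or_app; right.
    by apply: lO => // S Sl; apply: lG; apply: in_or_app; left.
exists l; split=> // G cG lG; apply: He; apply: Rle_lt_trans (_ : e / 2 < e); last lra.
by apply: Hn; apply: lO.
Qed.

Definition near_subset F (S : (Vec d -> Prop) -> Prop) := exists e, 0 < e /\
  forall G, closed_subgroup G -> dist F G < e -> S G.

(** A compact set missed by [F] is covered by finitely many balls of radius r around rational points
    at distance at least 2r from [F]; if the distances change by less than r, the balls are still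
    missed. For an open set, a rational ball around a point of [F] in it is still hit. *)
Lemma subbasis_near F S : closed_subgroup F -> chabauty_subbasis S -> S F -> near_subset F S.
Proof.
move=> cF; have [F0 [_ [_ clF]]] := cF; case=> [[K [cK SK]]|[U [oU SU]]].
  move/SK => FK.
  pose ix := {ke : rat_index (Fin.t d) * R | 0 < ke.2 /\ 2 * ke.2 <= rdist (I := Fin.t d) ke.1 F}.
  pose Gx (i : ix) (y : Vec d) := nrm (vminus (rat_point (proj1_sig i).1) y) < (proj1_sig i).2.
  have [||l Hl] := cK ix Gx.
  - by move=> i; apply: open_ball.
  - move=> x Kx; have nF : ~ F x by move=> Fx; apply: (FK x).
    have [e [e0 He]] := clF x nF.
    have [|k xk] := @rat_point_dense (Fin.t d) x (e / 3); first lra.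
    have le : 2 * (e / 3) <= rdist (I := Fin.t d) k F.
      apply: (rdist_ge F0) => h Fh; apply: Rnot_lt_le => lt; apply: (He h) => // j.
      rewrite Rabs_minus_sym; apply: Rle_lt_trans (nrm_coord (vminus (x : Fin.t d -> R) h) j) _.
      by apply: nrm_minus_lt xk lt _; lra.
    have p : 0 < (k, e / 3).2 /\ 2 * (k, e / 3).2 <= rdist (I := Fin.t d) (k, e / 3).1 F.
      by split=> //=; lra.
    by exists (exist _ (k, e / 3) p); rewrite /Gx /= nrm_minusC.
  have {Hl} Hl x : K x -> exists i, In i l /\ Gx i x := Hl x.
  suff [e [e0 He]] : exists e, 0 < e /\ forall G, closed_subgroup G -> dist F G < e ->
      forall i, In i l -> forall x, G x -> ~ Gx i x.
    exists e; split=> // G cG lt; apply/SK => x [Gx' Kx]; have [i [il ix']] := Hl x Kx.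
    exact: (He G cG lt i il x Gx').
  elim: (l) => [|[[k r] [/= r0 rF]] l' [e [e0 He]]]; first by exists 1; split=> //; lra.
  pose e' := Rmin e (Rmin (weight k) r).
  exists e'; split; first by do 2 apply: Rmin_glb_lt => //; apply: weight_gt0.
  have h1 := Rmin_l e (Rmin (weight k) r); have h2 := Rmin_r e (Rmin (weight k) r).
  have h3 := Rmin_l (weight k) r; have h4 := Rmin_r (weight k) r.
  move=> G cG lt i /= [<-|il] x Gx'; last by apply: (He G cG _ i il x Gx'); rewrite /e' in lt; lra.
  have [G0 _] := cG.
  have lt' := pdist_lt_coord lt (Rle_trans _ _ _ h2 h3).
  have := rdist_le G0 k Gx'; rewrite /Gx /=; move/Rabs_def2: lt'; rewrite /e'; lra.
move/SU => [x [Fx Ux]]; have [e [e0 He]] := oU x Ux.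
have [|k xk] := @rat_point_dense (Fin.t d) x (e / 2); first lra.
have lt : rdist (I := Fin.t d) k F < e / 2.
  by apply: Rle_lt_trans (rdist_le Fx k Fx) _; rewrite nrm_minusC.
pose e1 := e / 2 - rdist (I := Fin.t d) k F.
exists (Rmin (weight k) e1); split.
  by apply: Rmin_glb_lt; [exact: weight_gt0|rewrite /e1; lra].
move=> G [G0 _] ltG; have h1 := Rmin_r (weight k) e1.
have h2 := Rabs_def2 _ _ (pdist_lt_coord ltG (Rmin_l _ _)).
have [|y [Gy yk]] := rdist_lt G0 (k := k) (c := e / 2); first by rewrite /e1 in h1 h2; lra.
apply/SU; exists y; split=> //; apply: He => j.
rewrite Rabs_minus_sym; apply: Rle_lt_trans (nrm_coord (vminus (x : Fin.t d -> R) y) j) _.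
by apply: nrm_minus_lt xk yk _; lra.
Qed.

Lemma chabauty_coarser O : chabauty_open O ->
  exists O', opn (@rdist (Fin.t d)) O' /\ forall F, @closed_subgroup d F -> (O F <-> O' F).
Proof.
move=> oO; exists (intr (@rdist (Fin.t d)) (fun G => closed_subgroup G -> O G)).
split; first exact: opn_intr.
move=> F cF; split=> [OF|iF]; last exact: (intr_sub iF cF).
have [l [bl [lF lO]]] := oO F OF.
suff [e [e0 He]] : exists e, 0 < e /\ forall G, closed_subgroup G -> dist F G < e ->
    forall S, In S l -> S G.
  by exists e; split=> // G lt cG; apply: lO; apply: He.
elim: l bl lF {lO} => [|S l IH] bl lF; first by exists 1; split=> //; lra.
have [e [e0 He]] := IH (Forall_inv_tail bl) (fun S' h => lF S' (or_intror h)).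
have [e' [e'0 He']] := subbasis_near cF (Forall_inv bl) (lF S (or_introl erefl)).
exists (Rmin e e'); split; first exact: Rmin_glb_lt.
have h1 := Rmin_l e e'; have h2 := Rmin_r e e'.
by move=> G cG lt S' /= [<-|Sl]; [apply: He' => //; lra|apply: He => //; lra].
Qed.
End Chabauty.

Lemma chabauty_open_ext d (O U : (Vec d -> Prop) -> Prop) :
  (forall F, O F <-> U F) -> chabauty_open O -> chabauty_open U.
Proof.
move=> OU oO F /OU/oO[l [bl [lF lO]]]; exists l; split=> //; split=> // G lG.
by apply/OU; apply: lO.
Qed.

Theorem theorem8p2 : forall d : nat,
  indim_eq (@chabauty_open d) (@closed_subgroup d) (Nat.mul d d).
Proof.
move=> d.
have card : #|{: Fin.t d * Fin.t d}| = (d * d)%coq_nat by rewrite card_prod card_fin.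
split.
  (* The metric and the Chabauty topology agree on closed subgroups, so dimension passes between
     them along the identity. *)
  apply: (@ind_le_embed _ _ _ (opn (@rdist (Fin.t d))) id _ _ (@closed_subgroup d)).
  - exact: chabauty_open_ext.
  - by [].
  - exact: chabauty_finer.
  - exact: chabauty_coarser.
  by apply: ind_le_of_zd_cover; rewrite closed_subgroupE -card; apply: zd_cover_closed_subgroups.
move=> indS; apply: (@closed_subgroups_no_zd_cover (Fin.t d)); rewrite card -closed_subgroupE.
apply: zd_cover_of_ind_le.
apply: (@ind_le_embed _ _ _ (@chabauty_open d) id _ _ (@closed_subgroup d)) indS.
- by move=> O U OU; apply: opn_iff.
- by [].
- by move=> O /chabauty_coarser[O' [oO' OO']]; exists O'.
- by move=> O /chabauty_finer[O' [oO' OO']]; exists O'.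
Qed.
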